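(* Let $k\ge1$ be a fixed integer. As $b\to\infty$ through the integers $b>1$, the deviation $I(b,0,k)-b\log(b)$ admits an asymptotic expansion in inverse powers of $b$ to all orders. It depends on whether $k=1$, $k=2$ or $k\ge3$: $$I(b,0,1)=b\log(b)+\frac{\zeta(2)}{2b^3}+\frac{\zeta(2)}{2b^4}-\frac{3\zeta(2)+5\zeta(3)}{6b^5}-\frac{3\zeta(2)-\zeta(4)}{2b^6}+O(b^{-7}),$$ $$I(b,0,2)=b\log(b)+\frac{\zeta(2)}{2b^5}+\frac{\zeta(2)}{b^6}-\frac{\zeta(3)}{2b^7}-\frac{15\zeta(2)+8\zeta(3)-3\zeta(4)}{6b^8}+O(b^{-9}),$$ and, for $k\ge3$: \begin{align*} I(b,0,k)={}&b\log(b)+\frac{\zeta(2)}{2b^{2k+1}}+\frac{k\zeta(2)}{2b^{2k+2}}+\frac{(k^2-k-2)\zeta(2)-2\zeta(3)}{4b^{2k+3}}\\ &+\frac{(k^3-3k^2-10k-6)\zeta(2)-6k\zeta(3)+6\zeta(4)}{12b^{2k+4}}+O(b^{-2k-5}). \end{align*} (Implicit constants may depend on $k$.)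
   Context: For integers $b\ge 2$ and $k\ge 0$, $I(b,0,k)=\sum \frac1m$, where the sum runs over all integers $m>0$ whose base-$b$ representation (without leading zeros) contains exactly $k$ occurrences of the digit $0$ (this series converges). $\zeta$ is the Riemann zeta function. A function $f$ of the integer $b$ has an asymptotic expansion to all orders in inverse powers of $b$ if there are coefficients $a_n$ independent of $b$ (but depending on $k$) such that for every $N$, $f(b)=\sum_{n\le N}a_nb^{-n}+O(b^{-N-1})$ as $b\to\infty$. *)

(* Defs.v *)
From HB Require Import structures.
From mathcomp Require Import all_boot all_order all_algebra.
From mathcomp Require Import all_classical all_reals all_analysis.

Set Implicit Arguments.
Unset Strict Implicit.
Unset Printing Implicit Defensive.

Import Order.TTheory GRing.Theory Num.Theory numFieldNormedType.Exports.

Local Open Scope classical_set_scope.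
Local Open Scope ring_scope.

(* Least significant digit first; the leading digit has index [trunc_log b m],
   so for [1 < b] and [0 < m] there are no leading zeros. *)
Definition digits (b m : nat) : seq nat :=
  mkseq (fun i => (m %/ b ^ i) %% b)%N (trunc_log b m).+1.

(* [fine] is harmless: for [1 < b] and [d < b] the sum is finite. *)
Definition irwin_sum {R : realType} (b d k : nat) : R :=
  fine (\esum_(m in [set m : nat | (0 < m)%N /\ count_mem d (digits b m) = k])
          ((m%:R : R)^-1)%:E).

(* Dirichlet series; meaningful for [1 < s] only. *)
Definition zeta {R : realType} (s : R) : R :=
  limn (fun n => \sum_(1 <= m < n.+1) m%:R `^ (- s)).

Definition has_asymptotic_expansion {R : realType} (f : nat -> R) : Prop :=
  exists a : nat -> R, forall N : nat,
    f = (fun b => \sum_(n < N.+1) a n * b%:R ^- n)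
        +O_\oo (fun b => b%:R ^- N.+1 : R).

(* Main.v *)
Require Import Defs.
From HB Require Import structures.
From mathcomp Require Import all_boot all_order all_algebra.
From mathcomp Require Import all_classical all_reals all_analysis.
From mathcomp Require Import ring lra zify.

Import Order.TTheory GRing.Theory Num.Theory numFieldNormedType.Exports.

Local Open Scope classical_set_scope.
Local Open Scope ring_scope.

(** Attach to every word [w] of base-[b] digits with exactly [k] zeros the mass
    [b ^- |w|] at the point [0.w] of the unit interval. The resulting measure
    [mu_k] has mass [b] for every [k], and [1 / m] summed over the integers
    whose digits extend those of [y] by such a word is the Stieltjes transform
    [U_k y], the integral of [1 / (y + t)] for [mu_k]. Hence the Irwin sum is
    the sum of [U_k a] over the leading digits [0 < a < b] ([irwin_sumE]).

    Splitting off the first digit of a word gives, for [k >= 1], the functional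
    equation [U_k y = \sum_(0 < d < b) U_k (b y + d) + U_(k-1) (b y)]
    ([word_stieltjes_rec]). Summed over all the integers [1 <= y <= A], it yields
    [irwin_sum_shift]: the Irwin sum is the sum of [U_k n] over
    [A < n < b (A + 1)] plus the sum of [U_(k-1) (b a) - U_k (b a)] over
    [1 <= a <= A]. As [U_k n] lies between [b / (n + 1)] and [b / n], the first
    sum tends to [b ln b] as [A] grows ([sum_word_stieltjes_ln]). Expanding the
    second one in inverse powers of [b a], the sums over [a] become values of
    the zeta function, and the deviation from [b ln b] is
    [\sum_(m >= 1) (-1) ^ m zeta (m + 1) b ^ (- m) e_(k,m)], where [e_(k,m)] is
    the difference of the [m]-th normalized moments of [mu_(k-1)] and [mu_k]
    ([irwin_sum_expansion]).

    The self-similarity of [mu_k] also gives a triangular recursion for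
    [e_(k,m)] ([moment_drop_rec]), whose coefficients are polynomials in
    [x = 1 / b] and whose divisors [1 - x ^ m + x ^ m.+1] stay away from [0].
    So every [e_(k,m)] has an expansion in powers of [x], and since the series
    above converges geometrically, so has the deviation. For [k >= 1] the
    recursion gives [e_(k,m) = O (x ^ (2 k + 1))] for [m >= 2]
    ([moment_dropS_inv_bigO]), so that the terms with [m >= 4] are
    [O (x ^ (2 k + 5))], and the displayed coefficients come from the first terms
    of [e_(k,1)], [e_(k,2)] and [e_(k,3)]. Only [e_(k,2)] depends on whether
    [k = 1], [k = 2] or [k >= 3] to the order considered: the initial value
    [e_(0,2)], close to [- 1 / 3], contaminates its first coefficient for
    [k = 1] and its second one for [k = 2]. *)

(** * Integration against the measure of words with [k] zeros *)

Lemma cvgn_sum (R : realType) (m n : nat) (u : nat -> nat -> R) (l : nat -> R) :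
  (forall i, (m <= i < n)%N -> u i L @[L --> \oo] --> l i) ->
  \sum_(m <= i < n) u i L @[L --> \oo] --> \sum_(m <= i < n) l i.
Proof.
elim: n => [|n IH] ul.
  rewrite big_geq //; under eq_cvg do rewrite big_geq //; exact: cvg_cst.
have [mn|nm] := leqP m n; last first.
  rewrite big_geq //; under eq_cvg do rewrite big_geq //; exact: cvg_cst.
rewrite big_nat_recr //; under eq_cvg do rewrite big_nat_recr //.
apply: cvgD; last by apply: ul; rewrite mn /=.
by apply: IH => i /andP[mi ni]; apply: ul; rewrite mi /= ltnW.
Qed.

Section Words.
Variables (R : realType) (b : nat).
Hypothesis b_gt1 : (1 < b)%N.
Implicit Types (f g : R -> R) (k L m d : nat) (t y C : R).

(** The sum of [f (0.w) / b ^ |w|] over the words [w] of base-[b] digits of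
    length less than [L] with exactly [k] zeros, where [0.w] is the number of
    the unit interval whose base-[b] digits after the point are [w]. The
    recursion splits off the first digit; the empty word contributes [f 0]. *)
Fixpoint word_sum L k f : R :=
  if L is L'.+1 then
    (k == 0%N)%:R * f 0
    + b%:R^-1 * (\sum_(1 <= d < b) word_sum L' k (fun t => f ((d%:R + t) / b%:R))
                 + (if k is k'.+1 then word_sum L' k' (fun t => f (t / b%:R))
                    else 0))
  else 0.

Let b_gt0 : 0 < b%:R :> R.
Proof. by rewrite ltr0n; lia. Qed.

Let b_neq0 : b%:R != 0 :> R.
Proof. by rewrite gt_eqF. Qed.

Lemma shift_unit d t : (d < b)%N -> 0 <= t <= 1 -> 0 <= (d%:R + t) / b%:R <= 1.
Proof.
move=> db /andP[t0 t1]; apply/andP; split.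
  by rewrite divr_ge0 ?addr_ge0 ?ler0n ?(ltW b_gt0).
rewrite ler_pdivrMr // mul1r.
have : (d.+1%:R <= b%:R :> R) by rewrite ler_nat.
rewrite -addn1 natrD; lra.
Qed.

Lemma shift0_unit t : 0 <= t <= 1 -> 0 <= t / b%:R <= 1.
Proof.
by move=> t01; have := @shift_unit 0 t; rewrite add0r; apply => //; lia.
Qed.

Lemma eq_word_sum L k f g :
  (forall t, 0 <= t <= 1 -> f t = g t) -> word_sum L k f = word_sum L k g.
Proof.
elim: L k f g => [//|L IH] k f g fg /=.
rewrite fg ?lexx ?ler01 //; congr (_ + _ * (_ + _)).
  apply: eq_big_nat => d /andP[_ db].
  by apply: IH => t t01; apply/fg/shift_unit.
by case: k => [//|k]; apply: IH => t t01; apply/fg/shift0_unit.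
Qed.

Lemma word_sumD L k f g :
  word_sum L k (fun t => f t + g t) = word_sum L k f + word_sum L k g.
Proof.
elim: L k f g => [|L IH] k f g /=; first by rewrite addr0.
under eq_bigr do rewrite (IH k (fun t => f _) (fun t => g _)).
rewrite big_split /=; case: k => [|k]; first by ring.
by rewrite (IH k (fun t => f _) (fun t => g _)); ring.
Qed.

Lemma word_sumZ L k (c : R) f :
  word_sum L k (fun t => c * f t) = c * word_sum L k f.
Proof.
elim: L k f => [|L IH] k f /=; first by rewrite mulr0.
under eq_bigr do rewrite (IH k (fun t => f _)).
rewrite -mulr_sumr; case: k => [|k]; first by ring.
by rewrite (IH k (fun t => f _)); ring.
Qed.

Lemma word_sum_ge0 L k f :
  (forall t, 0 <= t <= 1 -> 0 <= f t) -> 0 <= word_sum L k f.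
Proof.
elim: L k f => [//|L IH] k f f0 /=.
apply: addr_ge0; first by rewrite mulr_ge0 ?f0 ?lexx ?ler01.
apply: mulr_ge0; first by rewrite invr_ge0 ltW.
apply: addr_ge0.
  rewrite big_nat_cond; apply: sumr_ge0 => d /andP[/andP[_ db] _].
  by apply: IH => t t01; apply/f0/shift_unit.
by case: k => [//|k]; apply: IH => t t01; apply/f0/shift0_unit.
Qed.

Lemma word_sum_nondecreasing k f :
  (forall t, 0 <= t <= 1 -> 0 <= f t) ->
  nondecreasing_seq (fun L => word_sum L k f).
Proof.
move=> f0; apply/nondecreasing_seqP => L.
elim: L k f f0 => [|L IH] k f f0; first exact: word_sum_ge0.
rewrite [leRHS]/= [leLHS]/= lerD2l ler_pM2l ?invr_gt0 //.
apply: lerD.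
  rewrite big_nat_cond [leRHS]big_nat_cond.
  apply: ler_sum => d /andP[/andP[_ db] _].
  by apply: IH => t t01; apply/f0/shift_unit.
by case: k => [//|k]; apply: IH => t t01; apply/f0/shift0_unit.
Qed.

Lemma word_sum1_le L k : word_sum L k (fun=> 1) <= b%:R.
Proof.
elim: L k => [|L IH] k /=; first exact: ltW.
rewrite [leRHS](_ : _ = 1 + b%:R^-1 * ((b%:R - 1) * b%:R)); last by field.
have hs : \sum_(1 <= d < b) word_sum L k (fun=> 1) <= (b%:R - 1) * b%:R.
  rewrite sumr_const_nat -[_ *+ (b - 1)]mulr_natl natrB 1?ltnW //.
  by rewrite ler_wpM2l // subr_ge0 ler1n ltnW.
case: k hs => [|k] hs.
  by rewrite eqxx mul1r addr0 lerD2l ler_pM2l ?invr_gt0.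
rewrite mul0r add0r.
apply: (@le_trans _ _ (b%:R^-1 * ((b%:R - 1) * b%:R + b%:R))).
  by rewrite ler_pM2l ?invr_gt0 // lerD.
by rewrite mulrDr mulVf // addrC.
Qed.

(** The integrands: functions bounded on the unit interval, where all the
    words [0.w] live. Values elsewhere are irrelevant. *)
Definition unit_bounded f := exists C, forall t, 0 <= t <= 1 -> `|f t| <= C.

Lemma unit_bounded_shift d f : (d < b)%N -> unit_bounded f ->
  unit_bounded (fun t => f ((d%:R + t) / b%:R)).
Proof. by move=> db [C fC]; exists C => t t01; apply/fC/shift_unit. Qed.

Lemma unit_bounded_shift0 f : unit_bounded f ->
  unit_bounded (fun t => f (t / b%:R)).
Proof. by move=> [C fC]; exists C => t t01; apply/fC/shift0_unit. Qed.

Lemma unit_bounded_exp m : unit_bounded (fun t => t ^+ m).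
Proof.
exists 1 => t /andP[t0 t1]; rewrite ger0_norm ?exprn_ge0 //.
exact: exprn_ile1.
Qed.

Lemma unit_boundedZ (c : R) f :
  unit_bounded f -> unit_bounded (fun t => c * f t).
Proof.
move=> [C fC]; exists (`|c| * C) => t t01.
by rewrite normrM ler_wpM2l // fC.
Qed.

Lemma unit_bounded_sum (I : Type) (r : seq I) (F : I -> R -> R) :
  (forall i, unit_bounded (F i)) ->
  unit_bounded (fun t => \sum_(i <- r) F i t).
Proof.
move=> hF; elim: r => [|i r [C hC]].
  by exists 0 => t _; rewrite big_nil normr0.
have [D hD] := hF i; exists (D + C) => t t01.
by rewrite big_cons (le_trans (ler_normD _ _)) // lerD ?hC ?hD.
Qed.

(** The integral of [f] for the measure [mu_k] that puts mass [b ^- |w|] at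
    [0.w] for every word [w] with exactly [k] zeros. The limit exists for the
    integrands of [unit_bounded]. *)
Definition word_integral k f : R := limn (fun L => word_sum L k f).

(** Partial sums of a nonnegative integrand increase and stay below [C * b],
    since [mu_k] has mass at most [b]. *)
Lemma word_sum_is_cvg_ge0 k f C :
  (forall t, 0 <= t <= 1 -> 0 <= f t <= C) -> cvgn (fun L => word_sum L k f).
Proof.
move=> fC; apply: nondecreasing_is_cvgn.
  by apply: word_sum_nondecreasing => t /fC/andP[].
exists (C * b%:R) => _ [L _ <-].
have C0 : 0 <= C 
  by have /andP[h /(le_trans h)] := fC 0 (ltac:(by rewrite lexx ler01)).
apply: (@le_trans _ _ (word_sum L k (fun=> C * 1))).
  rewrite -subr_ge0 -[X in _ - X]mul1r -mulNr -word_sumZ -word_sumD.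
  by apply: word_sum_ge0 => t /fC/andP[_]; lra.
by rewrite (word_sumZ L k C (fun=> 1)) ler_wpM2l // word_sum1_le.
Qed.

Lemma word_sum_cvg k f : unit_bounded f ->
  word_sum L k f @[L --> \oo] --> word_integral k f.
Proof.
move=> [C fC].
have e L : word_sum L k f
    = word_sum L k (fun t => f t + C) + - C * word_sum L k (fun=> 1).
  rewrite -word_sumZ -word_sumD; apply: eq_word_sum => t _; ring.
have c1 : cvgn (fun L => word_sum L k (fun t => f t + C)).
  apply: (@word_sum_is_cvg_ge0 _ _ (C + C)) => t /fC.
  by rewrite ler_norml => /andP[h1 h2]; apply/andP; split; lra.
have c2 : cvgn (fun L => word_sum L k (fun=> 1)).
  by apply: (@word_sum_is_cvg_ge0 _ _ 1) => t _; rewrite ler01 lexx.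
rewrite /word_integral.
have -> : (fun L => word_sum L k f)
  = (fun L => word_sum L k (fun t => f t + C) + - C * word_sum L k (fun=> 1)).
  exact/funext.
apply/cvg_ex; eexists; apply: cvgD; [exact: c1|].
by apply: cvgMl_tmp; exact: c2.
Qed.

Lemma eq_word_integral k f g :
  (forall t, 0 <= t <= 1 -> f t = g t) -> word_integral k f = word_integral k g.
Proof.
by move=> fg; congr (limn _); apply/funext => L; apply: eq_word_sum.
Qed.

Lemma word_integralD k f g : unit_bounded f -> unit_bounded g ->
  word_integral k (fun t => f t + g t) = word_integral k f + word_integral k g.
Proof.
move=> hf hg; apply/cvg_lim => //.
under eq_cvg do rewrite word_sumD.
by apply: cvgD; exact: word_sum_cvg.
Qed.

Lemma word_integralZ k (c : R) f : unit_bounded f ->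
  word_integral k (fun t => c * f t) = c * word_integral k f.
Proof.
move=> hf; apply/cvg_lim => //.
under eq_cvg do rewrite word_sumZ.
by apply: cvgMl_tmp; exact: word_sum_cvg.
Qed.

Lemma word_integral_sum (I : Type) (r : seq I) k (F : I -> R -> R) :
  (forall i, unit_bounded (F i)) ->
  word_integral k (fun t => \sum_(i <- r) F i t) = \sum_(i <- r) word_integral k (F i).
Proof.
move=> hF; elim: r => [|i r IH].
  rewrite big_nil -[RHS](mul0r (word_integral k (fun=> 1))) -word_integralZ.
    by apply: eq_word_integral => t _; rewrite big_nil mul0r.
  by exists 1 => t _; rewrite normr1.
rewrite big_cons -IH -word_integralD //; last exact: unit_bounded_sum.
by apply: eq_word_integral => t _; rewrite big_cons.
Qed.

(** Self-similarity of [mu_k] under splitting off the first digit. *)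
Lemma word_integral_rec k f : unit_bounded f ->
  word_integral k f = (k == 0%N)%:R * f 0
    + b%:R^-1 * (\sum_(1 <= d < b) word_integral k (fun t => f ((d%:R + t) / b%:R))
                 + (if k is k'.+1 then word_integral k' (fun t => f (t / b%:R))
                    else 0)).
Proof.
move=> hf.
have /cvg_lim <- // : word_sum L.+1 k f @[L --> \oo] --> word_integral k f.
  by have := word_sum_cvg k f hf; rewrite -[X in X -> _]cvg_shiftS.
apply/cvg_lim => //=; apply: cvgD; first exact: cvg_cst.
apply: cvgMl_tmp; apply: cvgD; last first.
  case: k => [|k]; first exact: cvg_cst.
  exact/word_sum_cvg/unit_bounded_shift0.
apply: cvgn_sum => d /andP[_ db].
exact/word_sum_cvg/unit_bounded_shift.
Qed.

(** The mass of [mu_k] is [b] for every [k]: it is the solution of the linear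
    equation given by self-similarity. *)
Lemma word_integral1 k : word_integral k (fun=> 1) = b%:R.
Proof.
have h : unit_bounded (fun=> 1) by exists 1 => t _; rewrite normr1.
have fixpt (w s : R) : w = s + b%:R^-1 * ((b%:R - 1) * w) -> w = b%:R * s.
  move=> e; have : b%:R * w = b%:R * s + (b%:R - 1) * w.
    by rewrite [in LHS]e mulrDr mulrA mulfV // mul1r.
  lra.
elim: k => [|k IH]; have := word_integral_rec _ _ h.
  move/(_ 0); rewrite sumr_const_nat -[_ *+ (b - 1)]mulr_natl natrB 1?ltnW //.
  by rewrite eqxx mul1r addr0 => /fixpt ->; rewrite mulr1.
move/(_ k.+1); rewrite sumr_const_nat -[_ *+ (b - 1)]mulr_natl natrB 1?ltnW // IH.
rewrite mul0r add0r mulrDr addrC mulVf // => /fixpt ->; exact: mulr1.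
Qed.

Lemma le_word_integral k f g : unit_bounded f -> unit_bounded g ->
  (forall t, 0 <= t <= 1 -> f t <= g t) -> word_integral k f <= word_integral k g.
Proof.
move=> hf hg fg; apply: ler_lim; [exact: word_sum_cvg|exact: word_sum_cvg|].
near=> L.
rewrite -subr_ge0 -[X in _ - X]mul1r -mulNr -word_sumZ -word_sumD.
by apply: word_sum_ge0 => t /fg; lra.
Unshelve. all: by end_near.
Qed.

Lemma word_integral_norm_le k f C : unit_bounded f ->
  (forall t, 0 <= t <= 1 -> `|f t| <= C) -> `|word_integral k f| <= C * b%:R.
Proof.
move=> hf fC; have h1 : unit_bounded (fun=> 1) by exists 1 => t _; rewrite normr1.
have hc (c : R) : word_integral k (fun=> c * 1) = c * b%:R.
  by rewrite word_integralZ ?word_integral1.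
rewrite ler_norml -mulNr -!hc; apply/andP; split; apply: le_word_integral => //;
  try exact: unit_boundedZ; move=> t /fC; rewrite ler_norml => /andP[]; lra.
Qed.

End Words.

Arguments word_sum {R} b L k f.
Arguments word_integral {R} b k f.
Arguments unit_bounded {R} f.

(** * Irwin sums as sums of Stieltjes transforms *)

(** Euclidean division by [b] turns a double sum into a single one. *)
Lemma sum_nat_mul (R : nmodType) (b m n : nat) (F : nat -> R) :
  (m <= n)%N ->
  \sum_(m <= i < n) \sum_(0 <= d < b) F (b * i + d)%N
  = \sum_(b * m <= j < b * n) F j.
Proof.
move=> /subnKC <-; elim: (n - m)%N => [|p IH]; first by rewrite addn0 !big_geq.
rewrite addnS big_nat_recr ?leq_addr //= IH.
rewrite [RHS](@big_cat_nat _ _ _ (b * (m + p))) /=; last 2 first.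
- by rewrite leq_mul2l leq_addr orbT.
- by rewrite leq_mul2l leqnSn orbT.
congr (_ + _); rewrite mulnS; set c := (b * (m + p))%N.
rewrite -[X in _ = \sum_(X <= _ < _) _]add0n big_addn addnK.
by apply: eq_bigr => d _; rewrite addnC.
Qed.

Section DigitTree.
Variables (R : realType) (b : nat).
Hypothesis b_gt1 : (1 < b)%N.
Implicit Types (k L m n d : nat) (t y C : R).

(** The Stieltjes transform of [mu_k]. For an integer [y > 0] it is the sum of
    [1 / m] over the integers [m] whose digits are those of [y] followed by a
    word with exactly [k] zeros. *)
Definition word_stieltjes k y : R := word_integral b k (fun t => (y + t)^-1).

(** The number of zero digits of [m > 0] in base [b]. *)
Definition zeros m := count_mem 0%N (digits b m).

Let b_gt0 : 0 < b%:R :> R.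
Proof. by rewrite ltr0n; lia. Qed.

Let b_neq0 : b%:R != 0 :> R.
Proof. by rewrite gt_eqF. Qed.

Lemma zeros_digit a : (0 < a < b)%N -> zeros a = 0%N.
Proof.
move=> /andP[a0 ab]; rewrite /zeros /digits.
have -> : trunc_log b a = 0%N by apply/eqP; rewrite trunc_log_eq0; lia.
by rewrite /mkseq /= expn0 divn1 modn_small //; case: a a0 {ab}.
Qed.

Lemma zeros_rcons n d : (0 < n)%N -> (d < b)%N ->
  zeros (b * n + d) = (zeros n + (d == 0))%N.
Proof.
move=> n0 db; rewrite /zeros /digits.
have -> : trunc_log b (b * n + d) = (trunc_log b n).+1.
  have /andP[h1 h2] := trunc_log_bounds b_gt1 n0.
  apply: trunc_log_eq => //; rewrite !expnS; apply/andP; split.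
    by rewrite (leq_trans _ (leq_addr _ _)) // leq_mul2l h1 orbT.
  apply: (@leq_trans (b * n.+1)); first by rewrite mulnS addnC ltn_add2r.
  by rewrite leq_mul2l -expnS h2 orbT.
rewrite /mkseq -[(trunc_log b n).+2]/(1 + (trunc_log b n).+1)%N iotaD map_cat.
rewrite count_cat addnC; congr addn; last first.
  by rewrite /= expn0 divn1 mulnC modnMDl modn_small // addn0.
rewrite (iotaDl 1 0) -map_comp; congr count; apply: eq_map => i /=.
rewrite expnS divnMA mulnC divnMDl ?(ltnW b_gt1) // [(d %/ b)%N]divn_small //.
by rewrite addn0.
Qed.

Lemma inv_word_shift y d t : 0 < y -> 0 <= t <= 1 ->
  b%:R^-1 * (y + (d%:R + t) / b%:R)^-1 = (b%:R * y + d%:R + t)^-1.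
Proof.
move=> y0 /andP[t0 t1]; rewrite -invfM; congr (_^-1).
by rewrite mulrDr mulrCA mulfV // mulr1 addrA.
Qed.

Lemma word_sum_inv_rec L k y : 0 < y ->
  word_sum b L.+1 k (fun t => (y + t)^-1)
  = (k == 0%N)%:R / y
    + \sum_(1 <= d < b) word_sum b L k (fun t => (b%:R * y + d%:R + t)^-1)
    + (if k is k'.+1 then word_sum b L k' (fun t => (b%:R * y + t)^-1) else 0).
Proof.
move=> y0; rewrite /= addr0 -addrA mulrDr mulr_sumr; congr (_ + (_ + _)).
  apply: eq_bigr => d _; rewrite -word_sumZ; apply: eq_word_sum => // t t01.
  exact: inv_word_shift.
case: k => [|k]; first by rewrite mulr0.
rewrite -word_sumZ; apply: eq_word_sum => // t t01.
by have := @inv_word_shift y 0 t y0 t01; rewrite add0r addr0.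
Qed.

Lemma unit_bounded_inv y : 0 < y -> unit_bounded (fun t => (y + t)^-1).
Proof.
move=> y0; exists y^-1 => t /andP[t0 t1].
by rewrite ger0_norm ?invr_ge0 ?lef_pV2 ?posrE ?addr_ge0 //; lra.
Qed.

(** Splitting off the first digit [d] of the word turns [y] into [b y + d]. *)
Lemma word_stieltjes_rec k y : 0 < y ->
  word_stieltjes k y
  = (k == 0%N)%:R / y + \sum_(1 <= d < b) word_stieltjes k (b%:R * y + d%:R)
    + (if k is k'.+1 then word_stieltjes k' (b%:R * y) else 0).
Proof.
move=> y0; have hb := unit_bounded_inv _ y0.
rewrite [LHS]word_integral_rec // addr0 -addrA mulrDr mulr_sumr; congr (_ + (_ + _)).
  apply: eq_big_nat => d /andP[_ db].
  rewrite -word_integralZ //; last first.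
    exact: (@unit_bounded_shift _ _ _ d (fun t => (y + t)^-1)).
  by apply: eq_word_integral => // t t01; exact: inv_word_shift.
case: k => [|k]; first by rewrite mulr0.
rewrite -word_integralZ //; last first.
  exact: (@unit_bounded_shift0 _ _ _ (fun t => (y + t)^-1)).
apply: eq_word_integral => // t t01.
by have := @inv_word_shift y 0 t y0 t01; rewrite add0r addr0.
Qed.

Lemma word_stieltjes_bounds k y : 0 < y ->
  b%:R / (y + 1) <= word_stieltjes k y <= b%:R / y.
Proof.
move=> y0; have h1 : unit_bounded (fun=> 1 : R) by exists 1 => t _; rewrite normr1.
have hc (c : R) : word_integral b k (fun=> c * 1) = b%:R * c.
  by rewrite word_integralZ ?word_integral1 // mulrC.
rewrite -!hc; apply/andP; split; apply: le_word_integral => //;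
  try exact: unit_boundedZ; try exact: unit_bounded_inv.
all: move=> t /andP[t0 t1]; rewrite mulr1 lef_pV2 ?posrE; lra.
Qed.

(** In the tree where the children of [n] are the integers [b n + d] with
    [d < b], the sum of [1 / m] over the [m] with [k] zeros among [n] and its
    descendants, fewer than [L] levels below [n]. *)
Fixpoint subtree_sum k L n : R :=
  if L is L'.+1 then
    (zeros n == k)%:R / n%:R + \sum_(0 <= d < b) subtree_sum k L' (b * n + d)
  else 0.

Lemma subtree_sumE k L n : (0 < n)%N ->
  subtree_sum k L n =
    if (zeros n <= k)%N then word_sum b L (k - zeros n) (fun t => (n%:R + t)^-1)
    else 0.
Proof.
elim: L n => [|L IH] n n0; first by case: ifP.
have bn0 d : (0 < b * n + d)%N by rewrite addn_gt0 muln_gt0 n0 andbT; lia.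
rewrite [LHS]/= big_ltn ?(ltnW b_gt1) // IH //.
have -> : \sum_(1 <= d < b) subtree_sum k L (b * n + d) =
  if (zeros n <= k)%N then \sum_(1 <= d < b) word_sum b L (k - zeros n)
     (fun t => (b%:R * n%:R + d%:R + t)^-1) else 0.
  case: ifPn => hk; last rewrite big_nat; last apply: big1 => d /andP[d1 db].
    apply: eq_big_nat => d /andP[d1 db].
    rewrite IH // zeros_rcons // [d == 0%N]gtn_eqF // addn0 hk.
    by apply: eq_word_sum => // t _; rewrite natrD natrM.
  by rewrite IH // zeros_rcons // [d == 0%N]gtn_eqF // addn0 (negbTE hk).
rewrite zeros_rcons ?(ltnW b_gt1) // eqxx addn1 addn0.
case: (ltngtP (zeros n) k) => hk.
- rewrite word_sum_inv_rec ?ltr0n // subn_eq0 leqNgt hk mul0r !add0r addrC.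
  congr (_ + _); rewrite subnS; have := hk; rewrite -subn_gt0.
  by case: (k - zeros n)%N => //= p _; apply: eq_word_sum => // t _; rewrite natrM.
- by rewrite mul0r !addr0.
- by rewrite word_sum_inv_rec ?ltr0n // hk subnn addr0 add0r.
Qed.

(** The integers [n] with [b ^ l <= n < b ^ l.+1] form the level [l] of the
    tree. *)
Lemma sum_subtree_sum k L l :
  \sum_(b ^ l <= n < b ^ l.+1) subtree_sum k L n
  = \sum_(b ^ l <= n < b ^ (l + L)) (zeros n == k)%:R / n%:R.
Proof.
elim: L l => [|L IH] l.
  by rewrite addn0 [RHS]big_geq //; apply: big1 => n _.
rewrite [LHS]big_split /= (sum_nat_mul _ _ _ _ (subtree_sum k L)); last first.
  by rewrite leq_exp2l.
rewrite -!expnS IH addSnnS -big_cat_nat //= leq_exp2l //; lia.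
Qed.

Lemma cvg_sum_zeros k :
  \sum_(0 <= m < b ^ L) ((0 < m)%N && (zeros m == k))%:R / m%:R @[L --> \oo]
  --> \sum_(1 <= a < b) word_stieltjes k a%:R.
Proof.
have e L : \sum_(0 <= m < b ^ L) ((0 < m)%N && (zeros m == k))%:R / m%:R
   = \sum_(1 <= a < b) word_sum b L k (fun t => (a%:R + t)^-1) :> R.
  have := sum_subtree_sum k L 0; rewrite expn0 expn1 add0n.
  rewrite (big_ltn (m := 0)) ?expn_gt0 ?(ltnW b_gt1) // mul0r add0r => h.
  transitivity (\sum_(1 <= n < b ^ L) (zeros n == k)%:R / n%:R : R).
    by apply: eq_big_nat => m /andP[-> _].
  rewrite -h; apply: eq_big_nat => a /andP[a1 ab].
  by rewrite subtree_sumE // zeros_digit ?a1 // subn0.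
under eq_cvg do rewrite e.
apply: cvgn_sum => a /andP[a1 _]; apply: word_sum_cvg => //.
by apply: unit_bounded_inv; rewrite ltr0n.
Qed.

Lemma irwin_sumE k : irwin_sum b 0 k = \sum_(1 <= a < b) word_stieltjes k a%:R.
Proof.
pose P m := (0 < m)%N && (zeros m == k).
pose u n : R := \sum_(0 <= m < n) (P m)%:R / m%:R.
set s := \sum_(1 <= a < b) _.
have us : u (b ^ L)%N @[L --> \oo] --> s := cvg_sum_zeros k.
have und : nondecreasing_seq u.
  apply/nondecreasing_seqP => n; rewrite /u big_nat_recr //= lerDl.
  by rewrite divr_ge0.
have ule n : u n <= s.
  apply: (@le_trans _ _ (u (b ^ n)%N)); first exact/und/ltnW/ltn_expl.
  have e : s = limn (fun L => u (b ^ L)%N) by apply/esym/cvg_lim.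
  rewrite e; apply: (@nondecreasing_cvgn_le _ (fun L => u (b ^ L)%N)).
    by move=> p q pq; apply: und; rewrite leq_exp2l.
  by apply/cvg_ex; exists s.
have ucv : cvgn u.
  by apply: nondecreasing_is_cvgn => //; exists s => _ [n _ <-].
have bL : (b ^ L)%N @[L --> \oo] --> \oo.
  apply/cvgnyPge => A; exists A => // n /= An.
  by rewrite (leq_trans An) // ltnW // ltn_expl.
have us' : u n @[n --> \oo] --> s.
  have e : s = limn u by exact: (cvg_unique _ us (cvg_comp _ _ bL ucv)).
  by rewrite e; exact: ucv.
rewrite /irwin_sum.
have -> : [set m | (0 < m)%N /\ count_mem 0%N (digits b m) = k] = [set m | P m].
  apply/seteqP; split => m; first by case=> h1 h2; apply/andP; split => //; apply/eqP.
  by case/andP => h1 /eqP h2.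
rewrite -nneseries_esum; last by move=> m _; rewrite lee_fin invr_ge0.
suff -> : (\sum_(0 <= m <oo | P m) (m%:R^-1)%:E = s%:E)%E by [].
apply/cvg_lim => //.
have e n : (\sum_(0 <= m < n | P m) (m%:R^-1)%:E)%E = (u n)%:E.
  rewrite sumEFin /u; congr (_%:E); rewrite big_mkcond /=.
  by apply: eq_bigr => m _; case: (P m); rewrite ?mul1r ?mul0r.
under eq_cvg do rewrite e.
exact: cvg_EFin (nearW _ _) us'.
Qed.

(** Summing the functional equation of [word_stieltjes] over [1 <= a <= A]
    cancels the small integers: the first sum tends to [b ln b] as [A] grows,
    and the second one carries the whole deviation. *)
Lemma irwin_sum_shift k A :
  irwin_sum b 0 k.+1
  = \sum_(A.+1 <= n < b * A.+1) word_stieltjes k.+1 n%:R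
    + \sum_(1 <= a < A.+1) (word_stieltjes k (b%:R * a%:R)
                            - word_stieltjes k.+1 (b%:R * a%:R)).
Proof.
rewrite irwin_sumE.
have h1 : \sum_(1 <= a < A.+1) word_stieltjes k.+1 a%:R =
   \sum_(b <= n < b * A.+1) word_stieltjes k.+1 n%:R
   + \sum_(1 <= a < A.+1) (word_stieltjes k (b%:R * a%:R)
                            - word_stieltjes k.+1 (b%:R * a%:R)).
  have := sum_nat_mul _ b 1 A.+1 (fun n => word_stieltjes k.+1 n%:R) isT.
  rewrite muln1 => <-; rewrite -big_split /=.
  apply: eq_big_nat => a /andP[a1 _].
  rewrite word_stieltjes_rec ?ltr0n // mul0r add0r.
  rewrite big_ltn ?(ltnW b_gt1) // addn0 natrM.
  under [in RHS]eq_bigr do rewrite natrD natrM.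
  lra.
have h2 : \sum_(1 <= n < b * A.+1) word_stieltjes k.+1 n%:R
  = \sum_(1 <= n < b) word_stieltjes k.+1 n%:R
    + \sum_(b <= n < b * A.+1) word_stieltjes k.+1 n%:R.
  by rewrite -big_cat_nat //= ?(ltnW b_gt1) // leq_pmulr.
have h3 : \sum_(1 <= n < b * A.+1) word_stieltjes k.+1 n%:R
  = \sum_(1 <= n < A.+1) word_stieltjes k.+1 n%:R
    + \sum_(A.+1 <= n < b * A.+1) word_stieltjes k.+1 n%:R.
  by rewrite -big_cat_nat //= leq_pmull // ltnW.
lra.
Qed.

(** Both [word_stieltjes k n] and [b (ln (n + 1) - ln n)] lie between
    [b / (n + 1)] and [b / n]; the bound is the telescoping sum of the lengths
    of these intervals. *)
Lemma sum_word_stieltjes_ln k A :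
  `|\sum_(A.+1 <= n < b * A.+1) word_stieltjes k n%:R - b%:R * ln b%:R|
  <= b%:R / A.+1%:R.
Proof.
have lnS n : (0 < n)%N ->
    (n%:R + 1)^-1 <= ln (n.+1%:R : R) - ln n%:R <= n%:R^-1.
  move=> n0; have n0' : 0 < n%:R :> R by rewrite ltr0n.
  have i0 : 0 < n%:R^-1 :> R by rewrite invr_gt0.
  rewrite -ln_div ?posrE ?ltr0n // -natr1.
  apply/andP; split.
    rewrite -lerN2 -lnV ?posrE ?divr_gt0 //.
    have -> : ((n%:R + 1) / n%:R)^-1 = 1 + - (n%:R + 1)^-1 :> R by field; lra.
    by apply: le_ln1Dx; rewrite ltrN2 invf_lt1; lra.
  have -> : (n%:R + 1) / n%:R = 1 + n%:R^-1 :> R by field; lra.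
  by apply: le_ln1Dx; lra.
have tel (B : nat) : (A.+1 <= B)%N ->
  `|\sum_(A.+1 <= n < B) word_stieltjes k n%:R - b%:R * (ln B%:R - ln A.+1%:R)|
    <= b%:R * (A.+1%:R^-1 - B%:R^-1).
  move=> /subnKC <-; elim: (B - A.+1)%N => [|p IH].
    by rewrite addn0 big_geq // !subrr mulr0 subr0 normr0.
  rewrite addnS big_nat_recr ?leq_addr //=.
  set n := (A.+1 + p)%N in IH *.
  have n0 : (0 < n)%N by rewrite addn_gt0.
  have /andP[l1 l2] := lnS n n0.
  have /andP[t1 t2] := @word_stieltjes_bounds k n%:R (ltac:(by rewrite ltr0n)).
  move: (ler_wpM2l (ltW b_gt0) l1) (ler_wpM2l (ltW b_gt0) l2) IH.
  rewrite -!(natr1 n) !ler_norml !mulrBr.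
  move: t1 t2; move: (b%:R / (n%:R + 1)) (b%:R / n%:R) (b%:R / A.+1%:R) => ? ? ?.
  move=> ? ? ? ? /andP[? ?]; apply/andP; split; lra.
have bA : (A.+1 <= b * A.+1)%N by rewrite leq_pmull // ltnW.
have := tel _ bA; rewrite natrM lnM ?posrE ?ltr0n //; last exact: ltnW.
rewrite addrK => /le_trans; apply; rewrite ler_pM2l // lerBlDr lerDl.
by rewrite invr_ge0 mulr_ge0.
Qed.

End DigitTree.

Arguments word_stieltjes {R} b k y.

(** * The deviation from [b ln b] as a series of moments *)

Section Zeta.
Variable R : realType.

Lemma sum_inv_pow_le2 s A : (2 <= s)%N ->
  \sum_(1 <= a < A.+1) a%:R ^- s <= 2 :> R.
Proof.
move=> s2; case: A => [|A]; first by rewrite big_geq.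
suff : \sum_(1 <= a < A.+2) a%:R ^- s <= 2 - A.+1%:R^-1 :> R.
  by move=> /le_trans; apply; rewrite gerBl invr_ge0.
elim: A => [|A IH]; first by rewrite big_nat1 expr1n invr1; lra.
rewrite big_nat_recr //=.
have h : A.+2%:R ^- s <= A.+1%:R^-1 - A.+2%:R^-1 :> R.
  have A0 : 0 < A.+1%:R :> R by rewrite ltr0n.
  apply: (@le_trans _ _ (A.+2%:R ^- 2)).
    by rewrite lef_pV2 ?posrE ?exprn_gt0 ?ltr0n // ler_weXn2l // ler1n.
  rewrite -(natr1 A.+1); move: (A.+1%:R) A0 => z z0.
  rewrite -subr_ge0 [leRHS](_ : _ = (z * (z + 1) ^+ 2)^-1); last by field; lra.
  by rewrite invr_ge0 ltW // mulr_gt0 // exprn_gt0 //; lra.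
by apply: le_trans (lerD IH h) _; rewrite addrA subrK.
Qed.

Lemma cvg_zeta s : (2 <= s)%N ->
  \sum_(1 <= a < A.+1) a%:R ^- s @[A --> \oo] --> zeta (s%:R : R).
Proof.
move=> s2; rewrite /zeta.
have -> : (fun n => \sum_(1 <= m < n.+1) m%:R `^ (- s%:R))
    = (fun A => \sum_(1 <= a < A.+1) a%:R ^- s) :> (nat -> R).
  by apply/funext => A; apply: eq_bigr => a _; rewrite powRN powR_mulrn.
apply: nondecreasing_is_cvgn.
  apply/nondecreasing_seqP => n; rewrite [leRHS]big_nat_recr //= lerDl.
  by rewrite invr_ge0 exprn_ge0.
by exists 2 => _ [A _ <-]; exact: sum_inv_pow_le2.
Qed.

End Zeta.

Section Moments.
Variables (R : realType) (b : nat).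
Hypothesis b_gt1 : (1 < b)%N.
Implicit Types (k m j n d : nat) (t y C : R).

Let b_gt0 : 0 < b%:R :> R.
Proof. by rewrite ltr0n; lia. Qed.

Let b_neq0 : b%:R != 0 :> R.
Proof. by rewrite gt_eqF. Qed.

(** The [m]-th moment of [mu_k], normalized by its mass. *)
Definition moment k m : R := word_integral b k (fun t => t ^+ m) / b%:R.

(** The Riemann sum of [t ^ n] over the points [d / b] with [0 < d < b]; the
    digit [0] is left out. *)
Definition power_mean n : R := b%:R ^- n.+1 * \sum_(1 <= d < b) d%:R ^+ n.

Lemma moment0 k : moment k 0 = 1.
Proof. by rewrite /moment word_integral1 // mulfV. Qed.

Lemma moment_norm_le1 k m : `|moment k m| <= 1.
Proof.
rewrite normrM [X in _ * X]gtr0_norm ?invr_gt0 // ler_pdivrMr //.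
apply: word_integral_norm_le => //; first exact: unit_bounded_exp.
move=> t /andP[t0 t1]; rewrite ger0_norm ?exprn_ge0 //; exact: exprn_ile1.
Qed.

(** The binomial expansion of [((d + t) / b) ^ m] in the self-similarity of
    [mu_k]; the term [j = m] has been moved to the left-hand side. *)
Lemma moment_rec k m : (0 < m)%N ->
  (1 - b%:R ^- m + b%:R ^- m.+1) * moment k m
  = \sum_(j < m) 'C(m, j)%:R * b%:R ^- j * power_mean (m - j) * moment k j
    + (if k is k'.+1 then b%:R ^- m.+1 * moment k' m else 0).
Proof.
move=> m0; set u := fun k j => word_integral b k (fun t : R => t ^+ j).
have hb n := @unit_bounded_exp R n.
have hbin d : word_integral b k (fun t : R => ((d%:R + t) / b%:R) ^+ m)
   = b%:R ^- m * \sum_(j < m.+1) 'C(m, j)%:R * d%:R ^+ (m - j) * u k j.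
  under eq_bigr do rewrite /u -word_integralZ //.
  rewrite -word_integral_sum //; last by move=> j; exact: unit_boundedZ.
  rewrite -word_integralZ //; last first.
    by apply: unit_bounded_sum => j; exact: unit_boundedZ.
  apply: eq_word_integral => // t _; rewrite exprMn exprDn exprVn mulrC; congr (_ * _).
  by apply: eq_bigr => j _; rewrite -mulr_natl mulrA.
have h0 k' : word_integral b k' (fun t : R => (t / b%:R) ^+ m) = b%:R ^- m * u k' m.
  rewrite -word_integralZ //; apply: eq_word_integral => // t _.
  by rewrite exprMn exprVn mulrC.
have := word_integral_rec R b b_gt1 k _ (hb m).
rewrite expr0n [m == 0%N]gtn_eqF // mulr0 add0r.
under eq_bigr do rewrite hbin.
rewrite -mulr_sumr exchange_big /= big_ord_recr /=.
under eq_bigr do (rewrite -mulr_suml -mulr_sumr).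
rewrite binn subnn -mulr_suml.
have uE k' j : u k' j = b%:R * moment k' j by rewrite mulrC divfK.
have -> : \sum_(1 <= d < b) 1 * d%:R ^+ 0 = b%:R - 1 :> R.
  by under eq_bigr do rewrite expr0 mul1r; rewrite sumr_const_nat natrB // ltnW.
have -> : \sum_(i < m) 'C(m, i)%:R * (\sum_(1 <= d < b) d%:R ^+ (m - i)) * u k i
    = b%:R ^+ m * b%:R ^+ 2 * (\sum_(j < m) 'C(m, j)%:R / b%:R ^+ j
        * power_mean (m - j) * moment k j).
  rewrite mulr_sumr; apply: eq_bigr => j _.
  have -> : b%:R ^+ m = b%:R ^+ j * b%:R ^+ (m - j) :> R.
    by rewrite -exprD subnKC // ltnW.
  rewrite uE /power_mean (exprS _ (m - j)).
  have : b%:R ^+ j != 0 :> R by rewrite expf_neq0.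
  have : b%:R ^+ (m - j) != 0 :> R by rewrite expf_neq0.
  move: (b%:R ^+ (m - j)) (b%:R ^+ j) (\sum_(1 <= d < b) _) => X Y Z X0 Y0.
  by field; rewrite ?X0 ?Y0 ?b_neq0.
rewrite -/(u k m) uE !(exprS _ m).
set T := \sum_(j < m) _.
have -> : (match k with 0%N => 0 | k'.+1 =>
    word_integral b k' (fun t : R => (t / b%:R) ^+ m) end)
  = b%:R ^- m * b%:R ^+ 2 * b%:R ^+ m *
    (match k with 0%N => 0 | k'.+1 => (b%:R * b%:R ^+ m)^-1 * moment k' m end).
  case: (k) => [|k']; first by rewrite mulr0.
  rewrite h0 uE; have : b%:R ^+ m != 0 :> R by rewrite expf_neq0.
  by move: (b%:R ^+ m) => X X0; field; rewrite ?X0 ?b_neq0.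
have : b%:R ^+ m != 0 :> R by rewrite expf_neq0.
move: (b%:R ^+ m) (moment k m) T => X w T X0.
have lin w' : b%:R * w = b%:R^-1 * (X^-1 * (X * b%:R ^+ 2 * T + (b%:R - 1) * (b%:R * w))
    + X^-1 * b%:R ^+ 2 * X * w') ->
    (1 - X^-1 + (b%:R * X)^-1) * w = T + w'.
  move=> /(congr1 (fun z => z / b%:R)) e.
  have {}e : w = T + X^-1 * (1 - b%:R^-1) * w + w'.
    transitivity (b%:R * w / b%:R); [by field|rewrite e; field].
    by rewrite b_neq0 X0.
  rewrite invfM; lra.
by move=> /lin.
Qed.

(** [moment (k - 1) m - moment k m]. The convention [moment (-1) m = 0] makes
    the recursion [moment_drop_rec] uniform in [k]. *)
Definition moment_drop k m : R :=
  if k is k'.+1 then moment k' m - moment k'.+1 m else - moment 0 m.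

Lemma moment_drop_rec k m : (0 < m)%N ->
  (1 - b%:R ^- m + b%:R ^- m.+1) * moment_drop k.+1 m
  = \sum_(1 <= j < m) 'C(m, j)%:R * b%:R ^- j * power_mean (m - j)
                      * moment_drop k.+1 j
    + b%:R ^- m.+1 * moment_drop k m.
Proof.
move=> m0; have -> : \sum_(1 <= j < m) 'C(m, j)%:R * b%:R ^- j
     * power_mean (m - j) * moment_drop k.+1 j
   = \sum_(j < m) 'C(m, j)%:R * b%:R ^- j * power_mean (m - j) * moment k j
   - \sum_(j < m) 'C(m, j)%:R * b%:R ^- j * power_mean (m - j) * moment k.+1 j.
  rewrite -sumrB -(big_mkord xpredT (fun j => 'C(m, j)%:R * b%:R ^- j
     * power_mean (m - j) * moment k j - 'C(m, j)%:R * b%:R ^- j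
     * power_mean (m - j) * moment k.+1 j)) [RHS]big_ltn //.
  rewrite !moment0 subrr add0r; apply: eq_bigr => j _; by rewrite -mulrBr.
rewrite [moment_drop k.+1 m]/= mulrBr !moment_rec //.
case: k => [|k] /=; by ring.
Qed.

Lemma geometric_remainder M y t : 0 < y -> 0 <= t ->
  (y + t)^-1 = \sum_(m < M) (-1) ^+ m / y ^+ m.+1 * t ^+ m
               + (-1) ^+ M * t ^+ M / (y ^+ M * (y + t)).
Proof.
move=> y0 t0; have yt : y + t != 0 by rewrite gt_eqF // ltr_wpDr.
have yn : y != 0 by rewrite gt_eqF.
elim: M => [|M IH]; first by rewrite big_ord0 add0r !expr0 !mul1r.
rewrite big_ord_recr /= [LHS]IH -!addrA; congr (_ + _); rewrite !exprS.
have : y ^+ M != 0 by rewrite expf_neq0.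
move: (y ^+ M) => Y Y0; field; by rewrite ?Y0 ?yt ?yn.
Qed.

Lemma word_stieltjes_expansion k M y : 0 < y ->
  `|word_stieltjes b k y - \sum_(m < M) (-1) ^+ m / y ^+ m.+1 * (b%:R * moment k m)|
  <= b%:R / y ^+ M.+1.
Proof.
move=> y0; have hb n := @unit_bounded_exp R n.
have -> : \sum_(m < M) (-1) ^+ m / y ^+ m.+1 * (b%:R * moment k m)
   = word_integral b k (fun t => \sum_(m < M) (-1) ^+ m / y ^+ m.+1 * t ^+ m).
  rewrite word_integral_sum //; last by move=> m; exact: unit_boundedZ.
  by apply: eq_bigr => m _; rewrite word_integralZ // /moment [b%:R * _]mulrC divfK.
have hs : unit_bounded (fun t => \sum_(m < M) (-1) ^+ m / y ^+ m.+1 * t ^+ m).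
  by apply: unit_bounded_sum => m; exact: unit_boundedZ.
rewrite -[X in `|_ - X|]mul1r -mulNr -word_integralZ // -word_integralD //; first last.
- exact: unit_boundedZ.
- exact: unit_bounded_inv.
have rem t : 0 <= t <= 1 -> `|(y + t)^-1
    + -1 * \sum_(m < M) (-1) ^+ m / y ^+ m.+1 * t ^+ m| <= (y ^+ M.+1)^-1.
  move=> /andP[t0 t1]; rewrite (geometric_remainder M) // mulN1r addrAC subrr add0r.
  rewrite !normrM normr_sign mul1r !ger0_norm ?exprn_ge0 ?invr_ge0 //; last first.
    by rewrite mulr_ge0 ?exprn_ge0 ?(ltW y0) // addr_ge0 // ltW.
  have p0 : 0 < y ^+ M by rewrite exprn_gt0.
  rewrite -[leRHS]mul1r; apply: ler_pM; rewrite ?exprn_ge0 ?invr_ge0 //.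
  - by rewrite mulr_ge0 ?(ltW p0) // addr_ge0 // ltW.
  - exact: exprn_ile1.
  - rewrite lef_pV2 ?posrE ?exprn_gt0 ?mulr_gt0 ?ltr_wpDr //.
    by rewrite exprSr ler_pM2l // lerDl.
rewrite [leRHS]mulrC; apply: word_integral_norm_le => //.
by exists (y ^+ M.+1)^-1; exact: rem.
Qed.

(** The deviation for [k + 1] is the sum over [m >= 1] of
    [(-1) ^ m zeta (m + 1) b ^ (- m) moment_drop (k + 1) m]: expand the second
    sum of [irwin_sum_shift] in inverse powers of [b a], sum over [a <= A], and
    let [A] tend to infinity. The bound is on the remainder after the terms
    [m < M]. *)
Lemma irwin_sum_expansion k M : (0 < M)%N ->
  `|irwin_sum b 0 k.+1 - b%:R * ln b%:R
    - \sum_(1 <= m < M) (-1) ^+ m * zeta (m.+1%:R) * b%:R ^- m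
                        * moment_drop k.+1 m|
  <= 4 * b%:R ^- M.
Proof.
move=> M0.
pose Z m A : R := \sum_(1 <= a < A.+1) a%:R ^- m.+1.
pose c m : R := (-1) ^+ m * b%:R ^- m * moment_drop k.+1 m.
set I := irwin_sum b 0 k.+1 - b%:R * ln b%:R.
have main A : `|I - \sum_(1 <= m < M) c m * Z m A|
    <= b%:R * harmonic A + 4 * b%:R ^- M.
  pose r a := word_stieltjes b k (b%:R * a%:R) - word_stieltjes b k.+1 (b%:R * a%:R)
    - \sum_(1 <= m < M) c m * a%:R ^- m.+1.
  have -> : I - \sum_(1 <= m < M) c m * Z m A
     = (\sum_(A.+1 <= n < b * A.+1) word_stieltjes b k.+1 n%:R - b%:R * ln b%:R)
       + \sum_(1 <= a < A.+1) r a.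
    rewrite sumrB exchange_big /= /I (irwin_sum_shift R b b_gt1 k A).
    under [in LHS]eq_bigr do rewrite mulr_sumr.
    by ring.
  apply: (le_trans (ler_normD _ _)); apply: lerD; first exact: sum_word_stieltjes_ln.
  have ra a : (0 < a)%N -> `|r a| <= 2 * b%:R ^- M * a%:R ^- M.+1.
    move=> a0; have y0 : 0 < b%:R * a%:R :> R by rewrite mulr_gt0 // ltr0n.
    have h1 := word_stieltjes_expansion k M _ y0.
    have h2 := word_stieltjes_expansion k.+1 M _ y0.
    have -> : r a = (word_stieltjes b k (b%:R * a%:R)
        - \sum_(m < M) (-1) ^+ m / (b%:R * a%:R) ^+ m.+1 * (b%:R * moment k m))
      - (word_stieltjes b k.+1 (b%:R * a%:R)
        - \sum_(m < M) (-1) ^+ m / (b%:R * a%:R) ^+ m.+1 * (b%:R * moment k.+1 m)).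
      suff e : \sum_(1 <= m < M) c m * a%:R ^- m.+1
        = \sum_(m < M) (-1) ^+ m / (b%:R * a%:R) ^+ m.+1 * (b%:R * moment k m)
        - \sum_(m < M) (-1) ^+ m / (b%:R * a%:R) ^+ m.+1 * (b%:R * moment k.+1 m).
        rewrite /r e; ring.
      rewrite -sumrB -(big_mkord xpredT (fun m =>
        (-1) ^+ m / (b%:R * a%:R) ^+ m.+1 * (b%:R * moment k m)
        - (-1) ^+ m / (b%:R * a%:R) ^+ m.+1 * (b%:R * moment k.+1 m))).
      rewrite [RHS]big_ltn // !moment0 subrr add0r; apply: eq_bigr => m _.
      rewrite /c -!mulrBr /= exprMn (exprS b%:R m) !invfM.
      have : b%:R ^+ m != 0 :> R by rewrite expf_neq0.
      move: (b%:R ^+ m) (a%:R ^- m.+1) ((-1) ^+ m) => X Y W X0.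
      by field; rewrite ?X0 ?b_neq0.
    apply: (le_trans (ler_normB _ _)); apply: (le_trans (lerD h1 h2)).
    rewrite exprMn (exprS b%:R M) !invfM -[_^-1 / _ / _]mulrA mulVKf //.
    by rewrite -mulr2n -mulrA mulr_natl.
  apply: (le_trans (ler_norm_sum _ _ _)).
  apply: (@le_trans _ _ (\sum_(1 <= a < A.+1) 2 * b%:R ^- M * a%:R ^- M.+1)).
    by apply: ler_sum_nat => a /andP[a1 _]; exact: ra.
  rewrite -mulr_sumr (_ : 4 * _ = 2 * b%:R ^- M * 2); last by ring.
  apply: ler_wpM2l; first by rewrite mulr_ge0 // invr_ge0 exprn_ge0.
  exact: sum_inv_pow_le2.
have Zcv m : (0 < m)%N -> Z m A @[A --> \oo] --> zeta (m.+1%:R : R).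
  by move=> m1; exact: (cvg_zeta R m.+1).
have cv1 : `|I - \sum_(1 <= m < M) c m * Z m A| @[A --> \oo] -->
    `|I - \sum_(1 <= m < M) c m * zeta m.+1%:R|.
  apply: cvg_norm; apply: cvgB; first exact: cvg_cst.
  apply: cvgn_sum => m /andP[m1 _]; by apply: cvgMl_tmp; exact: Zcv.
have cv2 : b%:R * harmonic A + 4 * b%:R ^- M @[A --> \oo] -->
    (4 * b%:R ^- M : R).
  move: (4 * b%:R ^- M : R) => X.
  have e : X = b%:R * 0 + X by rewrite mulr0 add0r.
  rewrite {2}e.
  apply: cvgD; last exact: cvg_cst.
  by apply: cvgMl_tmp; exact: cvg_harmonic.
have -> : \sum_(1 <= m < M) (-1) ^+ m * zeta m.+1%:R * b%:R ^- m * moment_drop k.+1 m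
  = \sum_(1 <= m < M) c m * zeta m.+1%:R :> R.
  by apply: eq_bigr => m _; rewrite /c; ring.
apply: ler_cvg_to cv1 cv2 _; exact: nearW.
Qed.

End Moments.

Arguments moment {R} b k m.
Arguments power_mean {R} b n.
Arguments moment_drop {R} b k m : simpl never.

(** * Functions with an expansion in inverse powers of [b] *)

Section InverseOrder.
Variable R : realType.
Implicit Types (f g : nat -> R) (n m N : nat) (p q : {poly R}).

(** [f b = O (b ^- n)], uniformly over all the bases [b > 1], so that no
    filter is involved. *)
Definition inv_bigO n f :=
  exists C, forall b, (1 < b)%N -> `|f b| <= C * b%:R^-1 ^+ n.

Let x0 b : 0 <= b%:R^-1 :> R.
Proof. by rewrite invr_ge0. Qed.

Let x1 b : (1 < b)%N -> b%:R^-1 <= 2^-1 :> R.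
Proof. by move=> b1; rewrite lef_pV2 ?posrE ?ltr0n ?ler_nat //; lia. Qed.

Lemma eq_inv_bigO n f g :
  (forall b, (1 < b)%N -> f b = g b) -> inv_bigO n f -> inv_bigO n g.
Proof. by move=> fg [C hC]; exists C => b b1; rewrite -fg // hC. Qed.

Lemma inv_bigOD n f g :
  inv_bigO n f -> inv_bigO n g -> inv_bigO n (fun b => f b + g b).
Proof.
move=> [C hC] [D hD]; exists (C + D) => b b1; rewrite mulrDl.
by rewrite (le_trans (ler_normD _ _)) // lerD ?hC ?hD.
Qed.

Lemma inv_bigOM n m f g :
  inv_bigO n f -> inv_bigO m g -> inv_bigO (n + m) (fun b => f b * g b).
Proof.
move=> [C hC] [D hD]; exists (C * D) => b b1; rewrite exprD mulrACA normrM.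
by rewrite ler_pM ?hC ?hD.
Qed.

Lemma leq_inv_bigO m n f : (m <= n)%N -> inv_bigO n f -> inv_bigO m f.
Proof.
move=> mn [C hC]; exists C => b b1; apply: (le_trans (hC b b1)).
have C0 : 0 <= C.
  have := le_trans (normr_ge0 _) (hC b b1).
  by rewrite pmulr_lge0 // exprn_gt0 // invr_gt0 ltr0n ltnW.
apply: ler_wpM2l => //; apply: ler_wiXn2l => //.
by apply: (le_trans (x1 _ b1)); lra.
Qed.

Lemma inv_bigO_cst (c : R) : inv_bigO 0 (fun=> c).
Proof. by exists `|c| => b _; rewrite mulr1. Qed.

Lemma inv_bigO_exp n : inv_bigO n (fun b => b%:R^-1 ^+ n).
Proof. by exists 1 => b _; rewrite mul1r ger0_norm // exprn_ge0. Qed.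

Lemma inv_bigO_inv : inv_bigO 0 (fun b => b%:R^-1).
Proof. by apply: (leq_inv_bigO _ 1) (inv_bigO_exp 1). Qed.

Lemma inv_bigON n f : inv_bigO n f -> inv_bigO n (fun b => - f b).
Proof. by move=> [C hC]; exists C => b b1; rewrite normrN hC. Qed.

Lemma inv_bigOB n f g :
  inv_bigO n f -> inv_bigO n g -> inv_bigO n (fun b => f b - g b).
Proof. by move=> hf /inv_bigON; exact: inv_bigOD. Qed.

Lemma inv_bigOZ n (c : R) f : inv_bigO n f -> inv_bigO n (fun b => c * f b).
Proof. by move=> hf; exact: inv_bigOM (inv_bigO_cst c) hf. Qed.

Lemma inv_bigO_sum n (i j : nat) (F : nat -> nat -> R) :
  (forall m, (i <= m < j)%N -> inv_bigO n (F m)) ->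
  inv_bigO n (fun b => \sum_(i <= m < j) F m b).
Proof.
elim: j => [|j IH] hF.
  by exists 0 => b _; rewrite big_geq // normr0 mul0r.
have [ij|ji] := leqP i j; last first.
  by exists 0 => b _; rewrite big_geq // normr0 mul0r.
apply: (@eq_inv_bigO _ (fun b => \sum_(i <= m < j) F m b + F j b)).
  by move=> b _; rewrite big_nat_recr.
apply: inv_bigOD; last by apply: hF; rewrite ij /=.
by apply: IH => m /andP[im mj]; apply: hF; rewrite im /= ltnW.
Qed.

(** The factor [1 - b ^- m + b ^- m.+1], which multiplies the unknown in the
    recursions for the moments, is at least [1 / 2]. *)
Lemma inv_bigO_cancel n m f : (0 < m)%N ->
  inv_bigO n (fun b => (1 - b%:R^-1 ^+ m + b%:R^-1 ^+ m.+1) * f b) ->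
  inv_bigO n f.
Proof.
move=> m0 [C hC]; exists (2 * C) => b b1.
have h : b%:R^-1 ^+ m <= 2^-1 :> R.
  case: m m0 {hC} => // m _; apply: le_trans (x1 _ b1).
  rewrite exprS ler_piMr // exprn_ile1 //; apply: le_trans (x1 _ b1) _; lra.
have h' : 0 <= b%:R^-1 ^+ m.+1 :> R by rewrite exprn_ge0.
have := hC b b1; rewrite normrM ger0_norm; last lra.
have : 2^-1 * `|f b| <= (1 - b%:R^-1 ^+ m + b%:R^-1 ^+ m.+1) * `|f b|.
  by apply: ler_wpM2r => //; lra.
move=> h1 /(le_trans h1) h2; rewrite -mulrA; lra.
Qed.

(** [f] is approximated to every order by a polynomial in [1 / b]. The
    polynomials for different orders are not required to be compatible; they
    are by [inv_bigO_horner_coef]. *)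
Definition inv_expandable f :=
  forall N, exists p, inv_bigO N (fun b => f b - p.[b%:R^-1]).

Lemma inv_bigO_horner p : inv_bigO 0 (fun b => p.[b%:R^-1]).
Proof.
elim/poly_ind: p => [|p c IH].
  by apply: (@eq_inv_bigO _ (fun=> 0)); [move=> b _; rewrite horner0|exact: inv_bigO_cst].
apply: (@eq_inv_bigO _ (fun b => p.[b%:R^-1] * b%:R^-1 + c)).
  by move=> b _; rewrite !hornerE.
apply: inv_bigOD; last exact: inv_bigO_cst.
exact: inv_bigOM IH inv_bigO_inv.
Qed.

Lemma inv_expandable_bounded f : inv_expandable f -> inv_bigO 0 f.
Proof.
move=> /(_ 0%N)[p hp].
apply: (@eq_inv_bigO _ (fun b => (f b - p.[b%:R^-1]) + p.[b%:R^-1])).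
  by move=> b _; rewrite subrK.
exact/inv_bigOD/inv_bigO_horner.
Qed.

Lemma eq_inv_expandable f g :
  (forall b, (1 < b)%N -> f b = g b) -> inv_expandable f -> inv_expandable g.
Proof.
move=> fg hf N; have [p hp] := hf N; exists p.
by apply: eq_inv_bigO hp => b b1; rewrite fg.
Qed.

Lemma inv_expandableD f g : inv_expandable f -> inv_expandable g ->
  inv_expandable (fun b => f b + g b).
Proof.
move=> hf hg N; have [p hp] := hf N; have [q hq] := hg N; exists (p + q).
apply: eq_inv_bigO (inv_bigOD _ _ _ hp hq) => b _.
by rewrite hornerD opprD addrACA.
Qed.

Lemma inv_expandableM f g : inv_expandable f -> inv_expandable g ->
  inv_expandable (fun b => f b * g b).
Proof.
move=> hf hg N; have [p hp] := hf N; have [q hq] := hg N; exists (p * q).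
have h1 := inv_bigOM _ _ _ _ (inv_expandable_bounded _ hf) hq.
have h2 := inv_bigOM _ _ _ _ (inv_bigO_horner q) hp.
apply: eq_inv_bigO (inv_bigOD _ _ _ h1 h2) => b _.
by rewrite hornerM; ring.
Qed.

Lemma inv_expandable_horner p : inv_expandable (fun b => p.[b%:R^-1]).
Proof.
by move=> N; exists p, 0 => b _; rewrite subrr normr0 mul0r.
Qed.

Lemma inv_expandable_cst (c : R) : inv_expandable (fun=> c).
Proof.
by apply: eq_inv_expandable (inv_expandable_horner c%:P) => b _; rewrite hornerC.
Qed.

Lemma inv_expandable_exp n : inv_expandable (fun b => b%:R^-1 ^+ n).
Proof.
apply: eq_inv_expandable (inv_expandable_horner 'X^n) => b _.
by rewrite hornerXn.
Qed.

Lemma inv_expandable_sum (i j : nat) (F : nat -> nat -> R) :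
  (forall m, (i <= m < j)%N -> inv_expandable (F m)) ->
  inv_expandable (fun b => \sum_(i <= m < j) F m b).
Proof.
elim: j => [|j IH] hF.
  apply: eq_inv_expandable (inv_expandable_cst 0) => b _.
  by rewrite big_geq.
have [ij|ji] := leqP i j; last first.
  apply: eq_inv_expandable (inv_expandable_cst 0) => b _.
  by rewrite big_geq.
apply: (@eq_inv_expandable (fun b => \sum_(i <= m < j) F m b + F j b)).
  by move=> b _; rewrite big_nat_recr.
apply: inv_expandableD; last by apply: hF; rewrite ij /=.
by apply: IH => m /andP[im mj]; apply: hF; rewrite im /= ltnW.
Qed.

Lemma inv_expandable_cancel m f : (0 < m)%N ->
  inv_expandable (fun b => (1 - b%:R^-1 ^+ m + b%:R^-1 ^+ m.+1) * f b) ->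
  inv_expandable f.
Proof.
move=> m0 hf N; have [p hp] := hf N.
pose r : {poly R} := 'X^m - 'X^(m.+1).
have rE b : r.[b%:R^-1] = b%:R^-1 ^+ m - b%:R^-1 ^+ m.+1.
  by rewrite /r !hornerE.
clearbody r.
(* 1 / (1 - r) is the truncated geometric series up to a multiple of r ^+ N. *)
exists (p * \sum_(i < N) r ^+ i).
apply: (inv_bigO_cancel _ m) => //.
have hr : inv_bigO 1 (fun b => r.[b%:R^-1]).
  apply: (@eq_inv_bigO _ (fun b => b%:R^-1 ^+ m - b%:R^-1 ^+ m.+1)).
    by move=> b _; rewrite rE.
  by apply: inv_bigOB; [apply: (leq_inv_bigO _ m)|apply: (leq_inv_bigO _ m.+1)];
    rewrite //; exact: inv_bigO_exp.
have hrN : inv_bigO N (fun b => r.[b%:R^-1] ^+ N).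
  elim: (N) => [|n IH]; first exact: inv_bigO_cst.
  apply: (@eq_inv_bigO _ (fun b => r.[b%:R^-1] * r.[b%:R^-1] ^+ n)).
    by move=> b _; rewrite exprS.
  exact: inv_bigOM hr IH.
have h2 := inv_bigOM _ _ _ _ (inv_bigO_horner p) hrN.
apply: eq_inv_bigO (inv_bigOD _ _ _ hp h2) => b _.
have : r ^+ N - 1 = (r - 1) * \sum_(i < N) r ^+ i by rewrite subrX1.
move=> /(congr1 (fun s => s.[b%:R^-1])).
rewrite hornerM !(hornerD, hornerN, hornerC) horner_exp => e.
have -> : 1 - b%:R^-1 ^+ m + b%:R^-1 ^+ m.+1 = 1 - r.[b%:R^-1] by rewrite rE; ring.
rewrite hornerM mulrBr -addrA; congr (_ + _).
have -> : r.[b%:R^-1] ^+ N = (r.[b%:R^-1] - 1) * (\sum_(i < N) r ^+ i).[b%:R^-1] + 1.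
  by rewrite -e subrK.
ring.
Qed.

(** Uniqueness of the coefficients of an expansion. *)
Lemma inv_bigO_horner_coef N p : inv_bigO N (fun b => p.[b%:R^-1]) ->
  forall i, (i < N)%N -> p`_i = 0.
Proof.
elim/poly_ind: p N => [|p c IH] N hp i iN; first by rewrite coef0.
case: N iN hp => // N iN hp.
have c0 : c = 0.
  have [C hC] : inv_bigO 1 (fun=> c).
    apply: (@eq_inv_bigO _ (fun b => (p * 'X + c%:P).[b%:R^-1]
                                     - p.[b%:R^-1] * b%:R^-1 ^+ 1)).
      by move=> b _; rewrite !hornerE expr1; ring.
    apply: inv_bigOB; first exact: leq_inv_bigO hp.
    by have := inv_bigOM _ _ _ _ (inv_bigO_horner p) (inv_bigO_exp 1).
  apply/eqP/negPn/negP => cn0.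
  have cp : 0 < `|c| by rewrite normr_gt0.
  pose b := (Num.bound `|C / `|c| |).+2.
  have := hC b isT; rewrite expr1 ler_pdivlMr ?ltr0n //.
  apply/negP; rewrite -ltNge mulrC -ltr_pdivrMr //.
  apply: (le_lt_trans (ler_norm _)).
  apply: (lt_le_trans (archi_boundP (normr_ge0 _))); rewrite ler_nat.
  exact: leqW (leqnSn _).
rewrite c0 addr0 coefMX in hp *.
case: i iN => //= i iN; apply: (IH N) => //.
have [C hC] := hp; exists C => b b1.
have := hC b b1; rewrite hornerMX normrM exprSr mulrA [X in _ * X <= _]ger0_norm //.
by rewrite ler_pM2r // invr_gt0 ltr0n ltnW.
Qed.

Lemma inv_bigO_truncate N p :
  inv_bigO N (fun b => p.[b%:R^-1] - \sum_(n < N) p`_n * b%:R^-1 ^+ n).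
Proof.
have := inv_bigOM _ _ _ _ (inv_bigO_horner (drop_poly N p)) (inv_bigO_exp N).
apply: eq_inv_bigO => b _.
have -> : p.[b%:R^-1] = \sum_(n < N) p`_n * b%:R^-1 ^+ n
    + (drop_poly N p).[b%:R^-1] * b%:R^-1 ^+ N.
  by rewrite -[in LHS](poly_take_drop N p) hornerD hornerM hornerXn horner_poly.
by rewrite [RHS]addrAC subrr add0r.
Qed.

Lemma eqaddO_inv_bigO n f g : inv_bigO n (fun b => f b - g b) ->
  f = g +O_\oo (fun b => b%:R ^- n : R).
Proof.
move=> [C hC]; apply/eqaddOP; near=> k; near=> b.
have b1 : (1 < b)%N by near: b; exists 2%N.
apply: (le_trans (hC b b1)); rewrite ger0_norm ?invr_ge0 ?exprn_ge0 // exprVn.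
by rewrite ler_wpM2r ?invr_ge0 ?exprn_ge0 //; near: k; exact: nbhs_pinfty_ge.
Unshelve. all: by end_near.
Qed.

Lemma inv_expandable_asymptotic f :
  inv_expandable f -> has_asymptotic_expansion f.
Proof.
move=> /choice[P hP]; exists (fun n => (P n.+1)`_n) => N.
apply: eqaddO_inv_bigO.
apply: eq_inv_bigO (inv_bigOD _ _ _ (hP N.+1) (inv_bigO_truncate N.+1 (P N.+1))) => b _.
rewrite addrA subrK; congr (_ - _); apply: eq_bigr => n _; rewrite exprVn.
congr (_ * _); apply/eqP; rewrite -subr_eq0 -coefB; apply/eqP.
apply: (inv_bigO_horner_coef n.+1) => //.
have h := leq_inv_bigO _ _ _ (ltn_ord n) (hP N.+1).
apply: eq_inv_bigO (inv_bigOB _ _ _ (hP n.+1) h) => c _.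
by rewrite hornerD hornerN; ring.
Qed.

End InverseOrder.

Arguments inv_bigO {R} n f.
Arguments inv_expandable {R} f.

(** * Expansions of the moments *)

Section MomentAsymptotics.
Variable R : realType.
Implicit Types (b k m n : nat).

(** The sum of [(d + 1) ^ n.+1 - d ^ n.+1] over [1 <= d < b] telescopes. *)
Lemma power_mean_rec b n : (1 < b)%N ->
  n.+1%:R * power_mean b n
  = 1 - b%:R^-1 ^+ n.+1
    - \sum_(0 <= j < n) 'C(n.+1, j)%:R * b%:R^-1 ^+ (n - j) * power_mean b j :> R.
Proof.
move=> b1; have bn0 : b%:R != 0 :> R by rewrite pnatr_eq0; lia.
pose G j : R := \sum_(1 <= d < b) d%:R ^+ j.
have tel : b%:R ^+ n.+1 - 1 = \sum_(0 <= j < n) 'C(n.+1, j)%:R * G j + n.+1%:R * G n.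
  have := telescope_sumr (fun d => d%:R ^+ n.+1 : R) (ltnW b1).
  rewrite expr1n => <-.
  transitivity (\sum_(1 <= d < b) \sum_(0 <= j < n.+1) 'C(n.+1, j)%:R * d%:R ^+ j : R).
    apply: eq_bigr => d _; rewrite -addn1 addnC natrD exprDn big_ord_recr /= binn.
    rewrite subnn mul1r mulr1n addrK big_mkord; apply: eq_bigr => j _.
    by rewrite expr1n mul1r mulr_natl.
  rewrite exchange_big /= big_nat_recr //= binSn.
  by congr (_ + _); [apply: eq_bigr => j _|]; rewrite mulr_sumr.
have -> : \sum_(0 <= j < n) 'C(n.+1, j)%:R * b%:R^-1 ^+ (n - j) * power_mean b j
  = b%:R ^- n.+1 * \sum_(0 <= j < n) 'C(n.+1, j)%:R * G j.
  rewrite mulr_sumr; apply: eq_big_nat => j /andP[_ jn].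
  have -> : b%:R ^- n.+1 = b%:R^-1 ^+ (n - j) * b%:R ^- j.+1 :> R.
    by rewrite -!exprVn -exprD addnS subnK // ltnW.
  by rewrite /power_mean -/(G j); ring.
move/(congr1 (fun z => b%:R ^- n.+1 * z)): tel.
rewrite mulrBr mulrDr mulVf ?expf_neq0 // mulr1 -exprVn => e.
rewrite /power_mean -/(G n) -exprVn mulrCA e; ring.
Qed.

Lemma power_mean0 b : (1 < b)%N -> power_mean b 0 = 1 - b%:R^-1 :> R.
Proof.
move=> b1; have := power_mean_rec b 0 b1.
by rewrite big_geq // mul1r subr0 expr1.
Qed.

Lemma power_mean1 b : (1 < b)%N ->
  power_mean b 1 = (1 - b%:R^-1) / 2 :> R.
Proof.
move=> b1; have := power_mean_rec b 1 b1.
rewrite big_nat1 power_mean0 // bin0 expr1 => e.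
apply: (mulfI (x := 2%:R)); rewrite ?pnatr_eq0 // e.
by move: (b%:R^-1) => x; field.
Qed.

Lemma power_mean2 b : (1 < b)%N ->
  power_mean b 2 = (1 - b%:R^-1) * (2 - b%:R^-1) / 6 :> R.
Proof.
move=> b1; have := power_mean_rec b 2 b1.
rewrite big_nat_recr //= big_nat1 power_mean0 // power_mean1 // bin0 bin1 expr1 => e.
apply: (mulfI (x := 3%:R)); rewrite ?pnatr_eq0 // e.
by move: (b%:R^-1) => x; field.
Qed.

Lemma inv_expandable_opp (f : nat -> R) :
  inv_expandable f -> inv_expandable (fun b => - f b).
Proof.
move=> hf; apply: eq_inv_expandable
  (inv_expandableM _ _ _ (inv_expandable_cst _ (-1)) hf) => b _.
exact: mulN1r.
Qed.

Lemma inv_expandable_power_mean n : inv_expandable (fun b => power_mean b n : R).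
Proof.
elim/ltn_ind: n => n IH.
apply: (@eq_inv_expandable _ (fun b => n.+1%:R^-1 * (1 + - (b%:R^-1 ^+ n.+1)
   + - \sum_(0 <= j < n) 'C(n.+1, j)%:R * b%:R^-1 ^+ (n - j) * power_mean b j))).
  move=> b b1; apply: (mulfI (x := n.+1%:R)); first by rewrite pnatr_eq0.
  by rewrite mulVKf ?pnatr_eq0 // power_mean_rec.
apply: inv_expandableM; first exact: inv_expandable_cst.
apply: inv_expandableD.
  apply: inv_expandableD; first exact: inv_expandable_cst.
  exact/inv_expandable_opp/inv_expandable_exp.
apply/inv_expandable_opp/inv_expandable_sum => j /andP[_ jn].
apply: inv_expandableM; last exact: IH.
apply: inv_expandableM; [exact: inv_expandable_cst|exact: inv_expandable_exp].
Qed.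

Lemma moment_drop_recV b k m : (1 < b)%N -> (0 < m)%N ->
  (1 - b%:R^-1 ^+ m + b%:R^-1 ^+ m.+1) * moment_drop b k.+1 m
  = \sum_(1 <= j < m) 'C(m, j)%:R * b%:R^-1 ^+ j * power_mean b (m - j)
                      * moment_drop b k.+1 j
    + b%:R^-1 ^+ m.+1 * moment_drop b k m :> R.
Proof.
move=> b1 m0; rewrite !exprVn moment_drop_rec //.
by congr (_ + _); apply: eq_bigr => j _; rewrite exprVn.
Qed.

Lemma moment_drop0_recV b m : (1 < b)%N -> (0 < m)%N ->
  (1 - b%:R^-1 ^+ m + b%:R^-1 ^+ m.+1) * moment_drop b 0 m
  = \sum_(1 <= j < m) 'C(m, j)%:R * b%:R^-1 ^+ j * power_mean b (m - j)
                      * moment_drop b 0 j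
    - power_mean b m :> R.
Proof.
move=> b1 m0; rewrite !exprVn mulrN moment_rec // addr0.
rewrite -(big_mkord xpredT (fun j => 'C(m, j)%:R * b%:R ^- j * power_mean b (m - j)
   * moment b 0 j)) big_ltn // moment0 // bin0 expr0 invr1 !mul1r mulr1 subn0.
rewrite opprD addrC -sumrN; congr (_ + _); apply: eq_bigr => j _.
by rewrite exprVn mulrN.
Qed.

Lemma inv_expandable_moment_drop k m : (0 < m)%N ->
  inv_expandable (fun b => moment_drop b k m : R).
Proof.
have hsum k' m' : (forall j, (0 < j < m')%N ->
    inv_expandable (fun b => moment_drop b k' j : R)) ->
  inv_expandable (fun b => \sum_(1 <= j < m') 'C(m', j)%:R * b%:R^-1 ^+ j
     * power_mean b (m' - j) * moment_drop b k' j : R).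
  move=> h; apply: inv_expandable_sum => j jm.
  apply: inv_expandableM; last exact: h.
  apply: inv_expandableM; last exact: inv_expandable_power_mean.
  by apply: inv_expandableM; [exact: inv_expandable_cst|exact: inv_expandable_exp].
elim: k m => [|k IHk]; elim/ltn_ind=> m IH m0.
  apply: (inv_expandable_cancel _ m) => //.
  apply: (@eq_inv_expandable _ (fun b => \sum_(1 <= j < m) 'C(m, j)%:R * b%:R^-1 ^+ j
     * power_mean b (m - j) * moment_drop b 0 j + - power_mean b m)).
    by move=> b b1; rewrite moment_drop0_recV.
  apply: inv_expandableD; last exact/inv_expandable_opp/inv_expandable_power_mean.
  by apply: hsum => j /andP[j0 jm]; apply: IH.
apply: (inv_expandable_cancel _ m) => //.
apply: (@eq_inv_expandable _ (fun b => \sum_(1 <= j < m) 'C(m, j)%:R * b%:R^-1 ^+ j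
   * power_mean b (m - j) * moment_drop b k.+1 j + b%:R^-1 ^+ m.+1 * moment_drop b k m)).
  by move=> b b1; rewrite moment_drop_recV.
apply: inv_expandableD; last exact: inv_expandableM (inv_expandable_exp _ _) (IHk _ m0).
by apply: hsum => j /andP[j0 jm]; apply: IH.
Qed.

Lemma inv_bigO_irwin_sum k M : (0 < M)%N ->
  inv_bigO M (fun b => irwin_sum b 0 k.+1 - b%:R * ln b%:R
    - \sum_(1 <= m < M) (-1) ^+ m * zeta m.+1%:R * b%:R^-1 ^+ m
                        * moment_drop b k.+1 m : R).
Proof.
move=> M0; exists 4 => b b1; rewrite exprVn.
under eq_bigr do rewrite exprVn.
exact: irwin_sum_expansion.
Qed.

Lemma inv_expandable_irwin_sum k :
  inv_expandable (fun b => irwin_sum b 0 k.+1 - b%:R * ln b%:R : R).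
Proof.
move=> N.
have hs : inv_expandable (fun b => \sum_(1 <= m < N.+1) (-1) ^+ m * zeta m.+1%:R
    * b%:R^-1 ^+ m * moment_drop b k.+1 m : R).
  apply: inv_expandable_sum => m /andP[m0 _].
  apply: inv_expandableM; last exact: inv_expandable_moment_drop.
  by apply: inv_expandableM; [exact: inv_expandable_cst|exact: inv_expandable_exp].
have [p hp] := hs N; exists p.
have hi := leq_inv_bigO _ _ _ _ (leqnSn N) (inv_bigO_irwin_sum k N.+1 isT).
by apply: eq_inv_bigO (inv_bigOD _ _ _ _ hi hp) => b _; rewrite addrA subrK.
Qed.

(** In [moment_drop_recV] the lower moments come with a factor [O (1 / b)],
    and the previous [k] with a factor [b ^- m.+1]; for [m > 1] this gains one
    order more than for [m = 1]. *)
Lemma moment_drop_inv_bigO_step k :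
  (forall m, (0 < m)%N -> inv_bigO k.*2 (fun b => moment_drop b k m : R)) ->
  forall m, (0 < m)%N ->
    inv_bigO k.*2.+2 (fun b => moment_drop b k.+1 m : R)
    /\ ((1 < m)%N -> inv_bigO k.*2.+3 (fun b => moment_drop b k.+1 m : R)).
Proof.
move=> hk; elim/ltn_ind => m IH m0.
have hs : inv_bigO k.*2.+3 (fun b => \sum_(1 <= j < m) 'C(m, j)%:R * b%:R^-1 ^+ j
   * power_mean b (m - j) * moment_drop b k.+1 j : R).
  apply: inv_bigO_sum => j /andP[j0 jm].
  have hx : inv_bigO 1 (fun b => 'C(m, j)%:R * b%:R^-1 ^+ j * power_mean b (m - j) : R).
    apply: (inv_bigOM _ 1 0); last exact/inv_expandable_bounded/inv_expandable_power_mean.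
    exact: inv_bigOZ (leq_inv_bigO _ _ _ _ j0 (inv_bigO_exp _ j)).
  exact: inv_bigOM hx (proj1 (IH j jm j0)).
have ht := inv_bigOM _ _ _ _ _ (inv_bigO_exp R m.+1) (hk m m0).
have key n : (n <= k.*2.+3)%N -> (n <= m.+1 + k.*2)%N ->
    inv_bigO n (fun b => moment_drop b k.+1 m : R).
  move=> n1 n2; apply: (inv_bigO_cancel _ n m) => //.
  apply: eq_inv_bigO (inv_bigOD _ _ _ _ (leq_inv_bigO _ _ _ _ n1 hs)
    (leq_inv_bigO _ _ _ _ n2 ht)) => b b1.
  by rewrite moment_drop_recV.
by split=> [|m1]; apply: key; lia.
Qed.

Lemma moment_drop_inv_bigO k m : (0 < m)%N ->
  inv_bigO k.*2 (fun b => moment_drop b k m : R).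
Proof.
elim: k m => [|k IH] m m0.
  exists 1 => b b1; rewrite mulr1 normrN; exact: moment_norm_le1.
exact: (moment_drop_inv_bigO_step k IH m m0).1.
Qed.

Lemma moment_dropS_inv_bigO k m : (1 < m)%N ->
  inv_bigO k.*2.+3 (fun b => moment_drop b k.+1 m : R).
Proof.
move=> m1; apply: (moment_drop_inv_bigO_step k _ m (ltnW m1)).2 => // n.
exact: moment_drop_inv_bigO.
Qed.

End MomentAsymptotics.

(** * The leading coefficients *)

Section LeadingTerms.
Variable R : realType.
Implicit Types (b k : nat) (x : R).

Lemma inv_bigO_cubic n (c0 c1 c2 c3 : R) :
  inv_bigO n (fun b => b%:R^-1 ^+ n
    * (c0 + c1 * b%:R^-1 + c2 * b%:R^-1 ^+ 2 + c3 * b%:R^-1 ^+ 3)).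
Proof.
have h := inv_bigO_horner R (c0%:P + c1%:P * 'X + c2%:P * 'X^2 + c3%:P * 'X^3).
rewrite -[X in inv_bigO X _]addn0.
apply: eq_inv_bigO (inv_bigOM _ _ _ _ _ (inv_bigO_exp _ n) h) => b _.
by rewrite !hornerE.
Qed.

Lemma moment_drop01E b : (1 < b)%N ->
  (1 - b%:R^-1 + b%:R^-1 ^+ 2) * moment_drop b 0 1 = - ((1 - b%:R^-1) / 2) :> R.
Proof.
move=> b1; rewrite -[X in 1 - X]expr1 moment_drop0_recV // big_geq //.
by rewrite power_mean1 // add0r.
Qed.

Lemma moment_drop02E b : (1 < b)%N ->
  (1 - b%:R^-1 ^+ 2 + b%:R^-1 ^+ 3) * moment_drop b 0 2
  = b%:R^-1 * (1 - b%:R^-1) * moment_drop b 0 1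
    - (1 - b%:R^-1) * (2 - b%:R^-1) / 6 :> R.
Proof.
move=> b1; rewrite moment_drop0_recV // big_nat1 power_mean2 // power_mean1 //.
by rewrite bin1 expr1; move: (b%:R^-1) (moment_drop b 0 1) => x e; field.
Qed.

Lemma moment_drop1E b k : (1 < b)%N ->
  (1 - b%:R^-1 + b%:R^-1 ^+ 2) * moment_drop b k.+1 1
  = b%:R^-1 ^+ 2 * moment_drop b k 1 :> R.
Proof.
move=> b1; rewrite -[X in 1 - X]expr1 moment_drop_recV // big_geq //.
by rewrite add0r.
Qed.

Lemma moment_drop2E b k : (1 < b)%N ->
  (1 - b%:R^-1 ^+ 2 + b%:R^-1 ^+ 3) * moment_drop b k.+1 2
  = b%:R^-1 * (1 - b%:R^-1) * moment_drop b k.+1 1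
    + b%:R^-1 ^+ 3 * moment_drop b k 2 :> R.
Proof.
move=> b1; rewrite moment_drop_recV // big_nat1 power_mean1 // bin1 expr1.
by move: (b%:R^-1) (moment_drop b k.+1 1) (moment_drop b k 2) => x e f; field.
Qed.

Lemma moment_drop3E b k : (1 < b)%N ->
  (1 - b%:R^-1 ^+ 3 + b%:R^-1 ^+ 4) * moment_drop b k.+1 3
  = b%:R^-1 * (1 - b%:R^-1) * (2 - b%:R^-1) / 2 * moment_drop b k.+1 1
    + 3 / 2 * b%:R^-1 ^+ 2 * (1 - b%:R^-1) * moment_drop b k.+1 2
    + b%:R^-1 ^+ 4 * moment_drop b k 3 :> R.
Proof.
move=> b1; rewrite moment_drop_recV // big_nat_recr //= big_nat1.
rewrite power_mean1 // power_mean2 // bin1 (_ : 'C(3, 2) = 3%N) // expr1.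
move: (b%:R^-1) (moment_drop b k.+1 1) (moment_drop b k.+1 2) => x e f.
by move: (moment_drop b k 3) => g; field.
Qed.

(** The expansion of [(1 - x) (1 - x + x ^ 2) ^ (- k - 1)] is [lead1 k x] up to
    [O (x ^ 4)]; [coef2] and [coef3] are its coefficients at [x ^ 2] and
    [x ^ 3]. *)
Definition coef2 k : R := (k%:R ^+ 2 - k%:R - 2) / 2.

Definition coef3 k : R := (k%:R ^+ 3 - 3 * k%:R ^+ 2 - 10 * k%:R - 6) / 6.

Definition lead1 k x : R := 1 + k%:R * x + coef2 k * x ^+ 2 + coef3 k * x ^+ 3.

Lemma moment_drop1_asymptotic k :
  inv_bigO (k.*2 + 4) (fun b => moment_drop b k 1
    + b%:R^-1 ^+ k.*2 / 2 * lead1 k b%:R^-1).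
Proof.
apply: (inv_bigO_cancel _ _ 1) => //.
elim: k => [|k IH].
  apply: eq_inv_bigO (inv_bigO_cubic 4 0 (- 2^-1) 0 0) => b b1.
  rewrite [RHS]mulrDr expr1 moment_drop01E // /lead1 /coef2 /coef3.
  by move: (b%:R^-1) => x; field.
have {}IH := inv_bigO_cancel _ _ 1 _ isT IH.
have h1 := inv_bigOM _ _ _ _ _ (inv_bigO_exp R 2) IH.
have h2 := inv_bigO_cubic (k.*2 + 6) ((coef2 k.+1 - coef3 k.+1) / 2)
  (coef3 k.+1 / 2) 0 0.
have e1 : (2 + (k.*2 + 4))%N = (k.+1.*2 + 4)%N by lia.
have e2 : (k.*2 + 6)%N = (k.+1.*2 + 4)%N by lia.
rewrite {}e1 in h1; rewrite {1}e2 in h2.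
apply: eq_inv_bigO (inv_bigOD _ _ _ _ h1 h2) => b b1.
rewrite [RHS]mulrDr expr1 moment_drop1E // doubleS !exprS exprD expr0.
move: (b%:R^-1) (moment_drop b k 1) => x e; move: (x ^+ k.*2) => y.
rewrite /lead1 /coef2 /coef3 -(natr1 k); move: (k%:R : R) => c.
by field.
Qed.

(** There is no term in [1 / b]. The value [- 1 / 3] enters the case [k = 1] as
    part of the coefficient [5 / 6 = 1 / 2 + 1 / 3]. *)
Lemma moment_drop02_asymptotic :
  inv_bigO 2 (fun b => moment_drop b 0 2 + 3^-1 : R).
Proof.
apply: (inv_bigO_cancel _ _ 2) => //.
have h1 := inv_bigOM _ _ _ _ _ (inv_bigO_cubic 1 1 (-1) 0 0)
  (moment_drop1_asymptotic 0).
have h2 := inv_bigO_cubic 3 (5 / 6) 0 (- 2^-1) 0.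
apply: eq_inv_bigO (inv_bigOD _ _ _ _ (leq_inv_bigO _ 2 _ _ _ h1)
  (leq_inv_bigO _ 2 _ _ _ h2)) => // b b1.
rewrite [RHS]mulrDr moment_drop02E // /lead1 /coef2 /coef3.
by move: (b%:R^-1) (moment_drop b 0 1) => x e; field.
Qed.

Lemma moment_drop12_asymptotic :
  inv_bigO 5 (fun b => moment_drop b 1 2 + 5 / 6 * b%:R^-1 ^+ 3 : R).
Proof.
apply: (inv_bigO_cancel _ _ 2) => //.
have h1 := inv_bigOM _ _ _ _ _ (inv_bigO_cubic 1 1 (-1) 0 0)
  (moment_drop1_asymptotic 1).
have h2 := inv_bigOM _ _ _ _ _ (inv_bigO_exp R 3) moment_drop02_asymptotic.
have h3 := inv_bigO_cubic 5 (1 / 6) (11 / 6) (- (3 / 2)) 0.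
apply: eq_inv_bigO (inv_bigOD _ _ _ _ (inv_bigOD _ _ _ _
  (leq_inv_bigO _ 5 _ _ _ h1) h2) h3) => // b b1.
rewrite [RHS]mulrDr moment_drop2E // /lead1 /coef2 /coef3.
by move: (b%:R^-1) (moment_drop b 1 1) (moment_drop b 0 2) => x e f; field.
Qed.

(** The leading coefficient at [k], which is [- c / 2], only enters the second
    coefficient at [k.+1]. Here [c] is [5 / 3] for [k = 1] and [1] from [k = 2]
    on, which is why the second coefficient is regular from [k = 3] on only. *)
Lemma moment_drop2_asymptotic_step k (c : R) :
  inv_bigO (k.*2 + 2) (fun b => moment_drop b k 2
    + c / 2 * b%:R^-1 ^+ k.*2 * b%:R^-1) ->
  inv_bigO (k.+1.*2 + 3) (fun b => moment_drop b k.+1 2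
    + b%:R^-1 ^+ k.+1.*2 / 2 * b%:R^-1 * (1 + (k%:R + c) * b%:R^-1)).
Proof.
move=> h; apply: (inv_bigO_cancel _ _ 2) => //.
have h1 := inv_bigOM _ _ _ _ _ (inv_bigO_cubic 1 1 (-1) 0 0)
  (moment_drop1_asymptotic k.+1).
have h2 := inv_bigOM _ _ _ _ _ (inv_bigO_exp R 3) h.
have h3 := inv_bigO_cubic (k.+1.*2 + 3)
  ((k.+1%:R - coef2 k.+1 - 1) / 2)
  ((coef2 k.+1 - coef3 k.+1 + 1 - (k%:R + c)) / 2)
  ((coef3 k.+1 + k%:R + c) / 2) 0.
apply: eq_inv_bigO (inv_bigOD _ _ _ _ (inv_bigOD _ _ _ _
  (leq_inv_bigO _ _ _ _ _ h1) (leq_inv_bigO _ _ _ _ _ h2)) h3);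
  [move=> b b1|lia|lia].
rewrite [RHS]mulrDr moment_drop2E // doubleS exprD !exprS expr0.
move: (b%:R^-1) (moment_drop b k.+1 1) (moment_drop b k 2) => x e f.
move: (x ^+ k.*2) => y.
rewrite /lead1 /coef2 /coef3 -(natr1 k); move: (k%:R : R) => d.
by field.
Qed.

Lemma moment_drop22_asymptotic :
  inv_bigO 7 (fun b => moment_drop b 2 2
    + b%:R^-1 ^+ 5 / 2 * (1 + 8 / 3 * b%:R^-1) : R).
Proof.
have h := leq_inv_bigO _ 4 5 _ isT moment_drop12_asymptotic.
have h' : inv_bigO (1.*2 + 2) (fun b => moment_drop b 1 2
    + 5 / 3 / 2 * b%:R^-1 ^+ 1.*2 * b%:R^-1 : R).
  apply: eq_inv_bigO h => b b1; move: (moment_drop b 1 2) (b%:R^-1) => e x.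
  by field.
apply: eq_inv_bigO (moment_drop2_asymptotic_step _ _ h') => b b1.
by move: (moment_drop b 2 2) (b%:R^-1) => e x; field.
Qed.

Lemma moment_drop2_asymptotic k : (2 < k)%N ->
  inv_bigO (k.*2 + 3) (fun b => moment_drop b k 2
    + b%:R^-1 ^+ k.*2 / 2 * b%:R^-1 * (1 + k%:R * b%:R^-1) : R).
Proof.
have step n : inv_bigO (n.*2 + 2) (fun b => moment_drop b n 2
    + 1 / 2 * b%:R^-1 ^+ n.*2 * b%:R^-1 : R) ->
  inv_bigO (n.+1.*2 + 3) (fun b => moment_drop b n.+1 2
    + b%:R^-1 ^+ n.+1.*2 / 2 * b%:R^-1 * (1 + n.+1%:R * b%:R^-1) : R).
  by move=> h; rewrite -(natr1 n); exact: moment_drop2_asymptotic_step.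
elim: k => [//|k IH]; rewrite ltnS leq_eqVlt => /orP[/eqP <-|k2]; apply: step.
  have h := inv_bigO_cubic 6 (- (4 / 3)) 0 0 0.
  apply: eq_inv_bigO (inv_bigOD _ _ _ _
    (leq_inv_bigO _ 6 _ _ _ moment_drop22_asymptotic) h) => // b b1.
  by move: (moment_drop b 2 2) (b%:R^-1) => e x; field.
have h := inv_bigO_cubic (k.*2 + 2) (- (k%:R / 2)) 0 0 0.
apply: eq_inv_bigO (inv_bigOD _ _ _ _
    (leq_inv_bigO _ _ _ _ _ (IH k2)) h); [move=> b b1|lia].
rewrite exprD; move: (moment_drop b k 2) (b%:R^-1) => e x.
by move: (x ^+ k.*2) => y; field.
Qed.

Lemma moment_drop3_asymptotic k :
  inv_bigO (k.+1.*2 + 2) (fun b => moment_drop b k.+1 3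
    + b%:R^-1 ^+ k.+1.*2 / 2 * b%:R^-1 : R).
Proof.
apply: (inv_bigO_cancel _ _ 3) => //.
have h1 := inv_bigOM _ _ _ _ _ (inv_bigO_cubic 1 1 (- (3 / 2)) (1 / 2) 0)
  (moment_drop1_asymptotic k.+1).
have h2 := inv_bigOM _ _ _ _ _ (inv_bigO_cubic 2 (3 / 2) (- (3 / 2)) 0 0)
  (moment_dropS_inv_bigO R k 2 isT).
have h3 := inv_bigOM _ _ _ _ _ (inv_bigO_exp R 4) (moment_drop_inv_bigO R k 3 isT).
have h4 := inv_bigO_cubic (k.+1.*2 + 2) (3 / 4) (- (1 / 4)) (- (1 / 2)) (1 / 2).
(* [h1] approximates the first moment drop by all of [lead1]; only its constant
   term matters at this order, and [h5] absorbs the other three. *)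
have h5 := inv_bigOM _ _ _ _ _ (inv_bigO_cubic 1 1 (- (3 / 2)) (1 / 2) 0)
  (inv_bigO_cubic (k.+1.*2 + 1) (- (k.+1%:R / 2)) (- (coef2 k.+1 / 2))
    (- (coef3 k.+1 / 2)) 0).
apply: eq_inv_bigO (inv_bigOD _ _ _ _ (inv_bigOD _ _ _ _ (inv_bigOD _ _ _ _
  (inv_bigOD _ _ _ _ (leq_inv_bigO _ _ _ _ _ h1) (leq_inv_bigO _ _ _ _ _ h2))
  (leq_inv_bigO _ _ _ _ _ h3)) h4) (leq_inv_bigO _ _ _ _ _ h5));
  [move=> b b1|lia|lia|lia|lia].
rewrite [RHS]mulrDr moment_drop3E // !exprD doubleS !exprS expr0 /lead1.
move: (b%:R^-1) (moment_drop b k.+1 1) (moment_drop b k.+1 2) => x e f.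
move: (moment_drop b k 3) (x ^+ k.*2) (k.+1%:R : R) (coef2 k.+1) (coef3 k.+1).
by move=> g y d c2 c3; field.
Qed.

(** To this order only the moments [m = 1, 2, 3] matter. The case distinction
    on [k] is confined to the approximation [E2] of the second one. *)
Lemma irwin_sum_asymptotic k (E2 : nat -> R) :
  inv_bigO (k.+1.*2 + 3) (fun b => moment_drop b k.+1 2 - E2 b) ->
  inv_bigO (k.+1.*2 + 5) (fun b => irwin_sum b 0 k.+1
    - (b%:R * ln b%:R
       + zeta 2 * (b%:R^-1 * b%:R^-1 ^+ k.+1.*2 / 2 * lead1 k.+1 b%:R^-1)
       + zeta 3 * (b%:R^-1 ^+ 2 * E2 b)
       + zeta 4 * (b%:R^-1 ^+ 4 * b%:R^-1 ^+ k.+1.*2 / 2)) : R).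
Proof.
move=> hE.
set M := (k.+1.*2 + 5)%N.
have hI := inv_bigO_irwin_sum R k M isT.
have h1 := inv_bigOM _ _ _ _ _ (inv_bigO_cubic 1 (- zeta 2) 0 0 0)
  (moment_drop1_asymptotic k.+1).
have h2 := inv_bigOM _ _ _ _ _ (inv_bigO_cubic 2 (zeta 3) 0 0 0) hE.
have h3 := inv_bigOM _ _ _ _ _ (inv_bigO_cubic 3 (- zeta 4) 0 0 0)
  (moment_drop3_asymptotic k).
have h4 : inv_bigO M (fun b => \sum_(4 <= m < M) (-1) ^+ m * zeta m.+1%:R
    * b%:R^-1 ^+ m * moment_drop b k.+1 m : R).
  apply: inv_bigO_sum => m /andP[m4 _].
  apply: (leq_inv_bigO _ _ (m + k.*2.+3)); first by rewrite /M; lia.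
  apply: inv_bigOM; first exact: inv_bigOZ (inv_bigO_exp _ m).
  by apply: moment_dropS_inv_bigO; lia.
apply: eq_inv_bigO (inv_bigOD _ _ _ _ (inv_bigOD _ _ _ _ (inv_bigOD _ _ _ _
  (inv_bigOD _ _ _ _ hI (leq_inv_bigO _ _ _ _ _ h1)) (leq_inv_bigO _ _ _ _ _ h2))
  (leq_inv_bigO _ _ _ _ _ h3)) h4); [move=> b b1|rewrite /M; lia ..].
have M3 : (3 < M)%N by rewrite /M; lia.
have [M2 M1] := (ltnW M3, ltnW (ltnW M3)).
rewrite (big_ltn M1) (big_ltn M2) (big_ltn M3).
move: (irwin_sum b 0 k.+1) (b%:R * ln b%:R) (\sum_(4 <= m < M) _) => I L S.
move: (b%:R^-1) (moment_drop b k.+1 1) (moment_drop b k.+1 2) => x e f.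
move: (moment_drop b k.+1 3) (x ^+ k.+1.*2) (lead1 k.+1 x) (E2 b) => g y l E.
by field.
Qed.

End LeadingTerms.

Theorem proposition8 (R : realType) (k : nat) (k_ge1 : (1 <= k)%N) :
  has_asymptotic_expansion
    (fun b : nat => irwin_sum b 0 k - b%:R * ln (b%:R : R))
  /\ (k = 1%N ->
      (fun b => irwin_sum b 0 1) =
        (fun b => b%:R * ln b%:R
         + zeta 2 / (2 * b%:R ^+ 3)
         + zeta 2 / (2 * b%:R ^+ 4)
         - (3 * zeta 2 + 5 * zeta 3) / (6 * b%:R ^+ 5)
         - (3 * zeta 2 - zeta 4) / (2 * b%:R ^+ 6))
        +O_\oo (fun b => b%:R ^- 7 : R))
  /\ (k = 2%N ->
      (fun b => irwin_sum b 0 2) =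
        (fun b => b%:R * ln b%:R
         + zeta 2 / (2 * b%:R ^+ 5)
         + zeta 2 / b%:R ^+ 6
         - zeta 3 / (2 * b%:R ^+ 7)
         - (15 * zeta 2 + 8 * zeta 3 - 3 * zeta 4) / (6 * b%:R ^+ 8))
        +O_\oo (fun b => b%:R ^- 9 : R))
  /\ ((3 <= k)%N ->
      (fun b => irwin_sum b 0 k) =
        (fun b => b%:R * ln b%:R
         + zeta 2 / (2 * b%:R ^+ (2 * k + 1))
         + k%:R * zeta 2 / (2 * b%:R ^+ (2 * k + 2))
         + ((k%:R ^+ 2 - k%:R - 2) * zeta 2 - 2 * zeta 3)
           / (4 * b%:R ^+ (2 * k + 3))
         + ((k%:R ^+ 3 - 3 * k%:R ^+ 2 - 10 * k%:R - 6) * zeta 2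
            - 6 * k%:R * zeta 3 + 6 * zeta 4)
           / (12 * b%:R ^+ (2 * k + 4)))
        +O_\oo (fun b => b%:R ^- (2 * k + 5) : R)).
Proof.
case: k k_ge1 => // k _; split.
  exact/inv_expandable_asymptotic/inv_expandable_irwin_sum.
have b0 b : (1 < b)%N -> b%:R != 0 :> R by rewrite pnatr_eq0; lia.
split=> [_|].
  apply: eqaddO_inv_bigO.
  have h : inv_bigO (1.*2 + 3)
      (fun b => moment_drop b 1 2 - - (5 / 6 * b%:R^-1 ^+ 3) : R).
    by apply: eq_inv_bigO (moment_drop12_asymptotic R) => b _; rewrite opprK.
  apply: eq_inv_bigO (irwin_sum_asymptotic R 0 _ h) => b /b0 bn0.
  rewrite /lead1 /coef2 /coef3; congr (_ - _).
  by move: (b%:R * ln b%:R) => L; field.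
split=> [_|].
  apply: eqaddO_inv_bigO.
  have h : inv_bigO (2.*2 + 3) (fun b => moment_drop b 2 2
      - - (b%:R^-1 ^+ 5 / 2 * (1 + 8 / 3 * b%:R^-1)) : R).
    by apply: eq_inv_bigO (moment_drop22_asymptotic R) => b _; rewrite opprK.
  apply: eq_inv_bigO (irwin_sum_asymptotic R 1 _ h) => b /b0 bn0.
  rewrite /lead1 /coef2 /coef3; congr (_ - _).
  by move: (b%:R * ln b%:R) => L; field.
move=> k3; apply: eqaddO_inv_bigO; rewrite mul2n.
have h : inv_bigO (k.+1.*2 + 3) (fun b => moment_drop b k.+1 2
    - - (b%:R^-1 ^+ k.+1.*2 / 2 * b%:R^-1 * (1 + k.+1%:R * b%:R^-1)) : R).
  by apply: eq_inv_bigO (moment_drop2_asymptotic R _ k3) => b _; rewrite opprK.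
apply: eq_inv_bigO (irwin_sum_asymptotic R k _ h) => b /b0 bn0.
rewrite /lead1 /coef2 /coef3 !exprD !exprVn; congr (_ - _).
have : b%:R ^+ k.+1.*2 != 0 :> R by rewrite expf_neq0.
move: (b%:R * ln b%:R) (b%:R ^+ k.+1.*2) (k.+1%:R : R) bn0 => L y c.
by move: (b%:R : R) => x xn0 yn0; field; rewrite ?xn0 ?yn0.
Qed.
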